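(* Let $G=(V,E)$ be a connected, locally finite simple graph with at least one edge and with girth $g(G)\geq 5$, and suppose that $G$ is Ricci-flat, i.e. $\kappa(x,y)=0$ for every edge $xy\in E$. Then $G$ is isomorphic to one of the following graphs: the infinite path, a cycle $C_n$ with $n\geq 6$, the dodecahedral graph, the Triplex, the Petersen graph, or the half-dodecahedral graph.
   Context: Let $G=(V,E)$ be a locally finite simple graph, let $d_x$ be the degree of $x\in V$, and let $d(x,y)$ be the length of a shortest path between $x$ and $y$. The girth $g(G)$ is the length of a shortest cycle ($\infty$ if there are no cycles). For a vertex $x$ and $p\in[0,1]$ define the probability measure $\mu_x^p$ on $V$ by $\mu_x^p(x)=p$, $\mu_x^p(z)=\frac{1-p}{d_x}$ if $z$ is adjacent to $x$, and $\mu_x^p(z)=0$ otherwise. The Wasserstein distance between probability measures $\mu_1,\mu_2$ on $V$ is $$W_1(\mu_1,\mu_2)=\inf_\pi\sum_{y\in V}\sum_{x\in V}d(x,y)\pi(x,y),$$ where the infimum runs over all $\pi:V\times V\to[0,1]$ with $\mu_1(x)=\sum_{y\in V}\pi(x,y)$ for all $x$ and $\mu_2(y)=\sum_{x\in V}\pi(x,y)$ for all $y$. For an edge $xy$, set $\kappa_p(x,y)=1-W_1(\mu_x^p,\mu_y^p)$ and define the (Lin-Lu-Yau) Ollivier-Ricci curvature by $$\kappa(x,y)=\lim_{p\to1}\frac{\kappa_p(x,y)}{1-p}.$$ The graphs in the conclusion are as follows. The infinite path is the two-way infinite path (vertex set $\mathbb{Z}$, with $i$ adjacent to $i+1$). $C_n$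 is the cycle on $n$ vertices. The dodecahedral graph is the 20-vertex cubic graph formed by the vertices and edges of the regular dodecahedron. The Triplex is the 12-vertex cubic graph with vertices $x_1,\dots,x_{12}$ whose edges are the edges of the 12-cycle $x_1x_2\cdots x_{12}x_1$ together with $x_1x_7,\ x_2x_{10},\ x_3x_8,\ x_4x_{12},\ x_5x_9,\ x_6x_{11}$. The Petersen graph is the 10-vertex cubic graph whose vertices are the 2-element subsets of a 5-element set, two being adjacent iff they are disjoint. The half-dodecahedral graph is the 15-vertex graph formed by one face of the dodecahedron and its five neighbouring faces: its vertices are $a_i,b_i,c_i$ ($i\in\mathbb{Z}/5$) and its edges are $a_ia_{i+1}$, $a_ib_i$, $b_ic_i$, $c_ib_{i+1}$ for $i\in\mathbb{Z}/5$. *)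

(* Defs.v *)
From HB Require Import structures.
From mathcomp Require Import all_boot all_order all_algebra.
From mathcomp Require Import finmap.
From mathcomp Require Import all_classical all_reals all_analysis.
Import Order.TTheory GRing.Theory Num.Theory.
Import numFieldNormedType.Exports.

Set Implicit Arguments.
Unset Strict Implicit.
Unset Printing Implicit Defensive.

Local Open Scope classical_set_scope.
Local Open Scope ring_scope.

(* A simple graph is a symmetric irreflexive relation [adj] on a choiceType,
   possibly infinite; V is a choiceType because [\esum] requires one. *)
Section Graph.
Variables (V : choiceType) (adj : rel V).

(* The vertex sequence of a path from x to y is x :: s; its length is size s. *)
Definition is_path (x y : V) (s : seq V) : Prop :=
  [/\ path adj x s, last x s = y & uniq (x :: s)].

Definition graph_connected : Prop := forall x y, exists s, is_path x y s.

Definition is_cycle (c : seq V) : Prop := ucycle adj c /\ (3 <= size c)%N.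

Definition locally_finite : Prop := forall x, finite_set [set y | adj x y].

Definition degree (x : V) : nat := #|` fset_set [set y | adj x y]|%fset.

Variable R : realType.

(* The infimum of the empty set is +oo. *)
Definition girth : \bar R :=
  ereal_inf [set ((size c)%:R)%:E | c in [set c | is_cycle c]].

Definition dist (x y : V) : \bar R :=
  ereal_inf [set ((size s)%:R)%:E | s in [set s | is_path x y s]].

Definition lazy_measure (p : R) (x z : V) : R :=
  if z == x then p else if adj x z then (1 - p) / (degree x)%:R else 0.

Definition is_coupling (mu1 mu2 : V -> R) (pi : V -> V -> R) : Prop :=
  [/\ forall x y, 0 <= pi x y <= 1,
      forall x, (mu1 x)%:E = \esum_(y in [set: V]) (pi x y)%:E
    & forall y, (mu2 y)%:E = \esum_(x in [set: V]) (pi x y)%:E].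

Definition transport_cost (pi : V -> V -> R) : \bar R :=
  (\esum_(y in [set: V]) \esum_(x in [set: V]) (dist x y * (pi x y)%:E))%E.

Definition W1 (mu1 mu2 : V -> R) : \bar R :=
  ereal_inf [set transport_cost pi | pi in [set pi | is_coupling mu1 mu2 pi]].

Definition kappa_p (p : R) (x y : V) : \bar R :=
  (1 - W1 (lazy_measure p x) (lazy_measure p y))%E.

(* kappa(x, y) = k: the limit exists and equals k.  It is one-sided since the
   measures are probability measures only for p in [0, 1]. *)
Definition has_curvature (x y : V) (k : R) : Prop :=
  (kappa_p p x y * ((1 - p)^-1)%:E)%E @[p --> 1^'-] --> k%:E.

Definition Ricci_flat : Prop := forall x y, adj x y -> has_curvature x y 0.

End Graph.

Definition graph_iso (V W : Type) (adjV : rel V) (adjW : rel W) : Prop :=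
  exists2 f : V -> W, bijective f & forall x y, adjV x y = adjW (f x) (f y).

Definition undirected (V : Type) (e : rel V) : rel V :=
  fun x y => e x y || e y x.

Definition infinite_path : rel int := undirected (fun i j : int => j == i + 1).

Definition cycle_graph (n : nat) : rel 'I_n :=
  undirected (fun i j : 'I_n => (j : nat) == i.+1 %% n)%N.

(* The vertices a_i, b_i, c_i are (0, i), (1, i), (2, i). *)
Definition half_dodecahedral : rel ('I_3 * 'Z_5) :=
  undirected (fun u v : 'I_3 * 'Z_5 =>
    match (u.1 : nat), (v.1 : nat) with
    | 0, 0 => (v.2 == u.2 + 1)%R
    | 0, 1 => v.2 == u.2
    | 1, 2 => v.2 == u.2
    | 2, 1 => (v.2 == u.2 + 1)%R
    | _, _ => false
    end%N).

(* The layers a, b, c, d of a Schlegel diagram: the face a, its five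
   neighbouring faces a_i a_(i+1) b_(i+1) c_i b_i, and the face d opposite
   to a, each d_i being joined to c_i. *)
Definition dodecahedral : rel ('I_4 * 'Z_5) :=
  undirected (fun u v : 'I_4 * 'Z_5 =>
    match (u.1 : nat), (v.1 : nat) with
    | 0, 0 => (v.2 == u.2 + 1)%R
    | 0, 1 => v.2 == u.2
    | 1, 2 => v.2 == u.2
    | 2, 1 => (v.2 == u.2 + 1)%R
    | 2, 3 => v.2 == u.2
    | 3, 3 => (v.2 == u.2 + 1)%R
    | _, _ => false
    end%N).

(* The vertex x_(i+1) is i : 'I_12; chords are listed with indices from 1. *)
Definition triplex : rel 'I_12 :=
  undirected (fun i j : 'I_12 =>
    ((j : nat) == i.+1 %% 12)
    || ((i.+1, j.+1) \in
          [:: (1, 7); (2, 10); (3, 8); (4, 12); (5, 9); (6, 11)]))%N.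

Definition petersen : rel {A : {set 'I_5} | #|A| == 2%N} :=
  fun A B => [disjoint val A & val B]%bool.

(* Main.v *)
Require Import Defs.
From HB Require Import structures.
From mathcomp Require Import all_boot all_order all_algebra.
From mathcomp Require Import finmap.
From mathcomp Require Import ring lra zify.
From mathcomp Require Import all_classical all_reals all_analysis.
Import Order.TTheory GRing.Theory Num.Theory.
Import numFieldNormedType.Exports.

Set Implicit Arguments.
Unset Strict Implicit.
Unset Printing Implicit Defensive.

Local Open Scope classical_set_scope.
Local Open Scope ring_scope.

(** In a graph of girth at least five, all that W_1 sees of an edge [xy] is the
    bipartite graph H between the remaining neighbours of [x] and those of [y],
    in which [u] and [v] are joined when they have a common neighbour, that is,
    when [u x y v] lies on a pentagon.  Joined vertices are at distance 2, the
    others at distance 3.  By Kantorovich duality the curvature of [xy] is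
    1/d_x + 1/d_y minus the largest weight of an independent set of H, where
    a neighbour of [x] weighs 1/d_x and a neighbour of [y] weighs 1/d_y.

    One half of the duality turns an independent set into a pair of potentials:
    in a flat graph its weight is at most 1/d_x + 1/d_y ([flat_independent]).
    The other half is needed only for three transport plans, which show that
    the curvature is positive at a leaf ([no_leaf]), at an edge of type (2,2)
    on a pentagon ([two_two_no_pentagon]) and at an edge of type (2,3) on two
    of them ([two_three_one_pentagon]).  It follows that all degrees are 2 or 3
    (degree 4 would make the four second neighbours span a triangle or a square,
    [degree_neq4]) and that H has no edge, exactly one edge, or a perfect
    matching when the degrees of the ends are (2,2), (2,3) or (3,3)
    ([flat_pair_nbrs]).

    From here on the argument is purely combinatorial.  If all degrees are 2,
    the graph is the image of a line under a map that is either injective or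
    periodic; girth and the absence of pentagons leave the periods from 6 on
    ([two_regular_iso]).  Otherwise some vertex of degree 3 lies on a pentagon.
    That pentagon and the third edge at the vertex are the root of a case
    analysis: choose a vertex whose neighbourhood is not entirely known, branch
    on all its possible neighbourhoods among old and new vertices, and discard
    the branches that contradict the local condition.  The tree is finite, with
    about two thousand nodes; in the remaining branches the graph is entirely
    known, by connectedness, and is one of the four exceptional graphs.  The
    tree is explored by computation ([search_seed]); that no branch is forgotten
    is a theorem about arbitrary searches of this kind ([search_sound]). *)

(** * The local condition that flatness imposes on an edge *)

Section LocalCondition.
Local Open Scope nat_scope.

(** [X] and [Y] are the remaining neighbours of the two ends of an edge and H
    is the graph of the pairs with a common neighbour. H has no edge, exactly
    one edge or a perfect matching, according to the sizes. Two relations stand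
    for H because the search knows it only partially: [sure] is a lower bound,
    used where H must have few edges, and [maybe] an upper bound, used where it
    must have many. *)
Definition flat_pair (T : Type) (sure maybe : rel T) (X Y : seq T) : bool :=
  match X, Y with
  | [:: a], [:: b] => ~~ sure a b
  | [:: a], [:: b; c] => ~~ (sure a b && sure a c) && (maybe a b || maybe a c)
  | [:: b; c], [:: a] => ~~ (sure b a && sure c a) && (maybe b a || maybe c a)
  | [:: a; b], [:: c; d] =>
      maybe a c && maybe b d || maybe a d && maybe b c
  | _, _ => false
  end.

Lemma adj_neq (V : eqType) (adj : rel V) x y :
  irreflexive adj -> adj x y -> x != y.
Proof. by move=> irr; apply: contraTneq => ->; rewrite irr. Qed.

Definition share (V : eqType) (adj : rel V) (N : V -> seq V) (x y : V) : bool :=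
  has (adj y) (N x).

Lemma share_sym (V : eqType) (adj : rel V) (N : V -> seq V) :
  (forall x y, (y \in N x) = adj x y) -> symmetric (share adj N).
Proof.
move=> memN x y; apply/hasP/hasP => -[w]; rewrite memN => xw yw.
  by exists w; rewrite ?memN.
by exists w; rewrite ?memN.
Qed.

(** All that the classification uses of a flat graph of girth at least five. *)
Record locally_flat (V : eqType) (adj : rel V) (N : V -> seq V) : Prop :=
  LocallyFlat {
  lf_sym : symmetric adj;
  lf_nbrs : forall x y, (y \in N x) = adj x y;
  lf_uniq : forall x, uniq (N x);
  lf_degree : forall x, 1 < size (N x) < 4;
  lf_triangle : forall x y z, adj x y -> adj x z -> adj y z -> False;
  lf_square : forall x y z w, x != y ->
    adj x z -> adj y z -> adj x w -> adj y w -> z = w;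
  lf_flat : forall x y, adj x y ->
    flat_pair (share adj N) (share adj N) (rem y (N x)) (rem x (N y)) }.

Lemma lf_irr (V : eqType) (adj : rel V) N :
  locally_flat adj N -> irreflexive adj.
Proof.
by move=> lf x; apply/negP => xx; apply: (lf_triangle lf xx xx xx).
Qed.

Lemma flat_pairC (T : Type) (r : rel T) X Y : symmetric r ->
  flat_pair r r X Y = flat_pair r r Y X.
Proof.
move=> rC; case: X => [|a [|b [|? ?]]]; case: Y => [|c [|d [|? ?]]] //=.
- by rewrite rC.
- by rewrite !(rC a).
- by rewrite !(rC c).
by rewrite !(rC a) !(rC b) [r d a && _]andbC.
Qed.

Lemma perm_eq2 (T : eqType) (a b : T) X :
  perm_eq X [:: a; b] -> X = [:: a; b] \/ X = [:: b; a].
Proof.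
move=> pX; have := perm_size pX; case: X pX => [|c [|d []]] //= pX _.
have := perm_mem pX c; rewrite !inE eqxx /= => /esym/orP[]/eqP ec; subst c.
  by left; move: pX; rewrite perm_cons => /perm_small_eq ->.
right; have pba : perm_eq [:: b; d] [:: b; a].
  by rewrite (perm_trans pX) // (perm_catC [:: a] [:: b]).
by move: pba; rewrite perm_cons => /perm_small_eq ->.
Qed.

Lemma flat_pair_perm (T : eqType) (sure maybe : rel T) X X' Y Y' :
  perm_eq X' X -> perm_eq Y' Y ->
  flat_pair sure maybe X Y -> flat_pair sure maybe X' Y'.
Proof.
case: X => [|a [|b []]] //; case: Y => [|c [|d []]] //.
- by move=> /perm_small_eq-> // /perm_small_eq->.
- move=> /perm_small_eq-> // /perm_eq2[]-> //=.
  by case: (sure a c); case: (sure a d); case: (maybe a c); case: (maybe a d).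
- move=> /perm_eq2[]-> // /perm_small_eq-> //=.
  by case: (sure a c); case: (sure b c); case: (maybe a c); case: (maybe b c).
move=> /perm_eq2[]-> /perm_eq2[]-> //=;
by case: (maybe a c); case: (maybe a d); case: (maybe b c); case: (maybe b d).
Qed.

(** What makes pruning legitimate: the condition passes from the graph to any
    bounds on H. *)
Lemma flat_pair_map (T U : eqType) (f : T -> U) (r : rel U)
    (sure maybe : rel T) X Y :
  (forall x y, x \in X -> y \in Y -> sure x y -> r (f x) (f y)) ->
  (forall x y, x \in X -> y \in Y -> r (f x) (f y) -> maybe x y) ->
  flat_pair r r (map f X) (map f Y) -> flat_pair sure maybe X Y.
Proof.
case: X => [|a [|b []]] //; case: Y => [|c [|d []]] //= s m.
- by apply: contra => /s -> //; rewrite inE.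
- case/andP=> n1 n2; apply/andP; split.
    apply: contra n1 => /andP[].
    by do 2![move/s ->; rewrite ?inE ?eqxx ?orbT //].
  by case/orP: n2 => /m -> //; rewrite ?inE ?eqxx ?orbT //.
- case/andP=> n1 n2; apply/andP; split.
    apply: contra n1 => /andP[].
    by do 2![move/s ->; rewrite ?inE ?eqxx ?orbT //].
  by case/orP: n2 => /m -> //; rewrite ?inE ?eqxx ?orbT //.
by case/orP=> /andP[/m h1 /m h2]; rewrite h1 ?h2 ?inE ?eqxx ?orbT.
Qed.

End LocalCondition.

(** * Bounds on the Wasserstein distance *)

Section Transport.
Variables (R : realType) (V : choiceType) (adj : rel V).
Local Notation dist := (dist adj R).
Local Notation W1 := (W1 adj).

Lemma esum_seq (r : seq V) (a : V -> \bar R) : uniq r ->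
    (forall z, (0 <= a z)%E) -> (forall z, z \notin r -> a z = 0%E) ->
  (\esum_(z in [set: V]) a z = \sum_(z <- r) a z)%E.
Proof.
move=> ur a0 ar; rewrite (fsbig_seq _ _ ur) -esum_fset //.
rewrite [RHS]esum_mkcond; apply: eq_esum => z _.
by case: ifPn => //; rewrite notin_setE => zr; rewrite ar //; apply/negP.
Qed.

Lemma dist_ge (k : nat) x y :
  (forall s, is_path adj x y s -> (k <= size s)%N) -> (k%:R%:E <= dist x y)%E.
Proof.
move=> ks; apply: le_ereal_inf_tmp => _ [s /ks + <-].
by rewrite lee_fin ler_nat.
Qed.

Lemma dist_le x y s : is_path adj x y s -> (dist x y <= (size s)%:R%:E)%E.
Proof. by move=> ps; apply: ereal_inf_lbound; exists s. Qed.

Lemma dist_ge0 x y : (0 <= dist x y)%E.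
Proof. exact: (@dist_ge 0). Qed.

(** The easy half of Kantorovich duality. The potentials need to be compatible
    only across the two supports, and they may differ from each other. *)
Lemma W1_ge (mu1 mu2 : V -> R) (r1 r2 : seq V) (phi psi : V -> R) :
    uniq r1 -> uniq r2 ->
    (forall z, z \notin r1 -> mu1 z = 0) ->
    (forall z, z \notin r2 -> mu2 z = 0) ->
    (forall u v, u \in r1 -> v \in r2 -> ((psi v - phi u)%:E <= dist u v)%E) ->
  ((\sum_(v <- r2) mu2 v * psi v - \sum_(u <- r1) mu1 u * phi u)%:E
    <= W1 mu1 mu2)%E.
Proof.
move=> u1 u2 m1 m2 lip; apply: le_ereal_inf_tmp => _ [pi [pi01 pi1 pi2] <-].
have pi_ge0 u v : 0 <= pi u v by have /andP[] := pi01 u v.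
have pi_out1 u v : u \notin r1 -> pi u v = 0.
  move=> ur; apply/eqP; rewrite eq_le pi_ge0 andbT -lee_fin.
  rewrite -[X in (_ <= X)%E](congr1 EFin (m1 _ ur)) pi1.
  apply: esum_ge; exists [set v]; first by split.
  by rewrite fsbig_set1.
have pi_out2 u v : v \notin r2 -> pi u v = 0.
  move=> vr; apply/eqP; rewrite eq_le pi_ge0 andbT -lee_fin.
  rewrite -[X in (_ <= X)%E](congr1 EFin (m2 _ vr)) pi2.
  apply: esum_ge; exists [set u]; first by split.
  by rewrite fsbig_set1.
have mu1E u : mu1 u = \sum_(v <- r2) pi u v.
  apply: EFin_inj; rewrite pi1 (@esum_seq r2) ?sumEFin // => v; last first.
    by move/pi_out2->.
  by rewrite lee_fin.
have mu2E v : mu2 v = \sum_(u <- r1) pi u v.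
  apply: EFin_inj; rewrite pi2 (@esum_seq r1) ?sumEFin // => u; last first.
    by move/pi_out1->.
  by rewrite lee_fin.
have term_ge0 u v : (0 <= dist u v * (pi u v)%:E)%E.
  by rewrite mule_ge0 ?dist_ge0 ?lee_fin.
have -> : transport_cost adj pi =
    (\sum_(v <- r2) \sum_(u <- r1) dist u v * (pi u v)%:E)%E.
  rewrite /transport_cost (@esum_seq r2) //.
  - apply: eq_bigr => v _; apply: esum_seq => // u /pi_out1 ->.
    by rewrite mule0.
  - by move=> v; apply: esum_ge0.
  by move=> v /pi_out2 vr; apply: esum1 => u _; rewrite vr mule0.
apply: (@le_trans _ _
  (\sum_(v <- r2) \sum_(u <- r1) (psi v - phi u) * pi u v)%:E); last first.
  rewrite -sumEFin big_seq [leRHS]big_seq; apply: lee_sum => v vr.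
  rewrite -sumEFin big_seq [leRHS]big_seq; apply: lee_sum => u ur.
  by rewrite EFinM lee_wpmul2r ?lee_fin // lip.
rewrite lee_fin le_eqVlt; apply/orP; left; apply/eqP.
under [in RHS]eq_bigr do under eq_bigr do rewrite mulrBl.
under [in RHS]eq_bigr do rewrite big_split /= sumrN.
rewrite big_split /= sumrN; congr (_ - _).
  by apply: eq_bigr => v _; rewrite mu2E mulrC mulr_sumr.
rewrite exchange_big /=; apply: eq_bigr => u _.
by rewrite mu1E mulrC mulr_sumr.
Qed.

(** A plan lists moves [(u, v, n, w)]: a mass [w] goes from [u] to [v], whose
    distance is at most [n]. A list, rather than a function on pairs, makes the
    marginals and the cost finite sums with explicit terms. *)
Lemma W1_le (mu1 mu2 : V -> R) (plan : seq (V * V * nat * R)) :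
    (forall t, t \in plan -> 0 <= t.2) -> \sum_(t <- plan) t.2 <= 1 ->
    (forall t, t \in plan -> (dist t.1.1.1 t.1.1.2 <= t.1.2%:R%:E)%E) ->
    (forall z, mu1 z = \sum_(t <- plan) t.2 * (t.1.1.1 == z)%:R) ->
    (forall z, mu2 z = \sum_(t <- plan) t.2 * (t.1.1.2 == z)%:R) ->
  (W1 mu1 mu2 <= (\sum_(t <- plan) t.2 * t.1.2%:R)%:E)%E.
Proof.
move=> w0 w1 wd m1 m2; apply: ge_ereal_inf.
pose mass (t : V * V * nat * R) u v : R :=
  t.2 * ((t.1.1.1 == u) && (t.1.1.2 == v))%:R.
pose pi u v := \sum_(t <- plan) mass t u v.
have mass_ge0 t u v : t \in plan -> 0 <= mass t u v.
  by move=> /w0 t0; rewrite mulr_ge0.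
have massE u v : (pi u v)%:E =
    (\sum_(t <- plan | t \in plan) (mass t u v)%:E)%E.
  by rewrite /pi -sumEFin big_seq.
exists (transport_cost adj pi); [exists pi => //; split|].
- move=> u v; apply/andP; split.
    by rewrite /pi big_seq sumr_ge0 // => t tp; exact: mass_ge0.
  apply: le_trans w1; rewrite /pi !big_seq; apply: ler_sum => t tp.
  by rewrite ler_piMr ?w0 //; case: (_ && _).
- move=> u; under eq_esum do rewrite massE.
  rewrite esum_sum; last by move=> v t _ tp; rewrite lee_fin mass_ge0.
  rewrite m1 -sumEFin [LHS]big_seq; apply: eq_bigr => t tp.
  rewrite (@esum_seq [:: t.1.1.2]) ?big_seq1 /mass ?eqxx ?andbT //.
    by move=> v; rewrite lee_fin mass_ge0.
  by move=> v; rewrite inE eq_sym => /negPf->; rewrite andbF mulr0.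
- move=> v; under eq_esum do rewrite massE.
  rewrite esum_sum; last by move=> u t _ tp; rewrite lee_fin mass_ge0.
  rewrite m2 -sumEFin [LHS]big_seq; apply: eq_bigr => t tp.
  rewrite (@esum_seq [:: t.1.1.1]) ?big_seq1 /mass ?eqxx //.
    by move=> u; rewrite lee_fin mass_ge0.
  by move=> u; rewrite inE eq_sym => /negPf->; rewrite mulr0.
have cost_ge0 u v t : t \in plan -> (0 <= dist u v * (mass t u v)%:E)%E.
  by move=> tp; rewrite mule_ge0 ?dist_ge0 ?lee_fin ?mass_ge0.
have -> : transport_cost adj pi =
    (\sum_(t <- plan | t \in plan) dist t.1.1.1 t.1.1.2 * t.2%:E)%E.
  rewrite /transport_cost.
  under eq_esum => v _.
    under eq_esum => u _.
      rewrite massE ge0_sume_distrr; last first.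
        by move=> t tp; rewrite lee_fin mass_ge0.
      over.
    rewrite esum_sum; last by move=> u t _ tp; apply: cost_ge0.
    over.
  rewrite esum_sum; last first.
    by move=> v t _ tp; apply: esum_ge0 => u _; apply: cost_ge0.
  apply: eq_bigr => t tp; rewrite (@esum_seq [:: t.1.1.2]) // ?big_seq1.
  - rewrite (@esum_seq [:: t.1.1.1]) // ?big_seq1.
    + by rewrite /mass !eqxx mulr1.
    + by move=> u; apply: cost_ge0.
    by move=> u; rewrite inE /mass eq_sym => /negPf ->; rewrite mulr0 mule0.
  - by move=> v; apply: esum_ge0 => u _; apply: cost_ge0.
  move=> v; rewrite inE eq_sym => /negPf vt; apply: esum1 => u _.
  by rewrite /mass vt andbF mulr0 mule0.
rewrite -sumEFin [leRHS]big_seq; apply: lee_sum => t tp.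
by rewrite mulrC EFinM lee_wpmul2r ?lee_fin ?w0 // wd.
Qed.

(** [1 - W1 <= (1 - p) * c] bounds the quotient that defines the curvature by
    [c] for every idleness, so the limit 0 is at most [c]. *)
Lemma slope_ge0 x y (c : R) : has_curvature adj x y (0 : R) ->
    (forall p : R, 0 < p < 1 ->
      ((1 - (1 - p) * c)%:E
         <= W1 (lazy_measure adj p x) (lazy_measure adj p y))%E) ->
  0 <= c.
Proof.
move=> flat Wc; rewrite -lee_fin; apply: (cvge_to_le flat).
near=> p; have p0 : 0 < p by near: p; apply: nbhs_left_gt.
have p1 : p < 1 by near: p; apply: nbhs_left_lt.
have q0 : 0 < 1 - p by rewrite subr_gt0.
have -> : c%:E = (((1 - p) * c)%:E * ((1 - p)^-1)%:E)%E.
  by rewrite -EFinM mulrAC mulfV ?mul1r ?gt_eqF.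
apply: lee_wpmul2r; first by rewrite lee_fin invr_ge0 ltW.
have -> : ((1 - p) * c)%:E = (1 - (1 - (1 - p) * c)%:E)%E.
  by rewrite -EFinB; congr EFin; lra.
by rewrite /kappa_p leeB // Wc // p0 p1.
Unshelve. all: by end_near. Qed.

(** Idleness above 1/2 suffices since only the limit at 1 matters; it ensures
    that the plans below have nonnegative masses. *)
Lemma slope_le0 x y (c : R) : has_curvature adj x y (0 : R) ->
    (forall p : R, 2^-1 < p < 1 ->
      (W1 (lazy_measure adj p x) (lazy_measure adj p y)
         <= (1 - (1 - p) * c)%:E)%E) ->
  c <= 0.
Proof.
move=> flat Wc; rewrite -lee_fin; apply: (cvge_to_ge flat).
near=> p; have p0 : 2^-1 < p.
  by near: p; apply: nbhs_left_gt; rewrite invf_lt1 ?ltr1n.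
have p1 : p < 1 by near: p; apply: nbhs_left_lt.
have q0 : 0 < 1 - p by rewrite subr_gt0.
have -> : c%:E = (((1 - p) * c)%:E * ((1 - p)^-1)%:E)%E.
  by rewrite -EFinM mulrAC mulfV ?mul1r ?gt_eqF.
apply: lee_wpmul2r; first by rewrite lee_fin invr_ge0 ltW.
have -> : ((1 - p) * c)%:E = (1 - (1 - (1 - p) * c)%:E)%E.
  by rewrite -EFinB; congr EFin; lra.
by rewrite /kappa_p leeB // Wc // p0 p1.
Unshelve. all: by end_near. Qed.

End Transport.

(** * Curvature of an edge in a graph of girth at least five *)

Section FlatGraph.
Variables (R : realType) (V : choiceType) (adj : rel V).
Hypotheses (adj_sym : symmetric adj) (adj_irr : irreflexive adj).
Hypothesis adj_fin : locally_finite adj.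
Hypothesis adj_girth : (5%:R%:E <= girth adj R)%E.
Hypothesis adj_flat : Ricci_flat adj R.

Definition nbrs (x : V) : seq V := fset_set [set y | adj x y].
Local Notation N := nbrs.
Local Notation dist := (dist adj R).
Local Notation mu := (lazy_measure adj).

Lemma mem_nbrs x y : (y \in N x) = adj x y.
Proof.
rewrite (in_fset_set (adj_fin x)); apply/idP/idP; first by move/set_mem.
by move=> xy; apply/mem_set.
Qed.

Lemma nbrs_uniq x : uniq (N x). Proof. exact: fset_uniq. Qed.

Lemma degreeE x : degree adj x = size (N x). Proof. by []. Qed.

Lemma cycle_ge5 c : is_cycle adj c -> (5 <= size c)%N.
Proof.
move=> cc; rewrite -(ler_nat R) -lee_fin; apply: le_trans adj_girth _.
by apply: ereal_inf_lbound; exists c.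
Qed.

Let adj_neq x y : adj x y -> x != y := @adj_neq V adj x y adj_irr.

Lemma no_triangle x y z : adj x y -> adj x z -> adj y z -> False.
Proof.
move=> xy xz yz; suff /cycle_ge5 : is_cycle adj [:: x; y; z] by [].
split=> //; apply/andP; split; first by rewrite /= xy yz adj_sym xz.
by rewrite /= !inE negb_or !adj_neq.
Qed.

Lemma no_square x y z w : x != y ->
  adj x z -> adj y z -> adj x w -> adj y w -> z = w.
Proof.
move=> xy xz yz xw yw; apply/eqP; case: (boolP (z == w)) => // zw.
suff /cycle_ge5 : is_cycle adj [:: x; z; y; w] by [].
have [zx wy] : adj z y /\ adj w x by rewrite !(adj_sym _ y) !(adj_sym _ x).
split=> //; apply/andP; split; first by rewrite /= xz zx yw wy.
rewrite /= !inE !negb_or xy zw !adj_neq //.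
Qed.

Lemma mem_rem_nbrs x y z : (z \in rem y (N x)) = (z != y) && adj x z.
Proof. by rewrite mem_rem_uniq ?nbrs_uniq // inE /= mem_nbrs. Qed.

Lemma nbrs_rem x y : adj x y -> perm_eq (N x) (y :: rem y (N x)).
Proof. by move=> xy; apply: perm_to_rem; rewrite mem_nbrs. Qed.

Lemma size_nbrs x y : adj x y -> size (N x) = (size (rem y (N x))).+1.
Proof. by move=> /nbrs_rem/perm_size. Qed.

(** As a combination of point masses, the measure can be compared with the
    marginals of an explicit plan by field arithmetic. *)
Lemma lazy_measureE (p : R) x z : mu p x z =
  p * (x == z)%:R + (1 - p) / (size (N x))%:R * \sum_(w <- N x) (w == z)%:R.
Proof.
have sumE (s : seq V) : uniq s -> \sum_(w <- s) (w == z)%:R = (z \in s)%:R :> R.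
  move=> us; have [zs|zs] := boolP (z \in s).
    rewrite (bigD1_seq z) //= eqxx big1 ?addr0 // => w /negPf wz.
    by rewrite wz.
  rewrite big_seq big1 // => w ws; case: eqP => // wz.
  by rewrite -wz ws in zs.
rewrite sumE ?nbrs_uniq // mem_nbrs /lazy_measure degreeE eq_sym.
case: eqP => [->|_]; first by rewrite adj_irr mulr1 mulr0 addr0.
by rewrite mulr0 add0r; case: (adj x z); rewrite ?mulr1 ?mulr0.
Qed.

Lemma lazy_sum (p : R) x (phi : V -> R) :
  \sum_(z <- x :: N x) mu p x z * phi z =
  p * phi x + (1 - p) / (size (N x))%:R * \sum_(z <- N x) phi z.
Proof.
rewrite big_cons /lazy_measure eqxx; congr (_ + _).
rewrite mulr_sumr; apply: eq_big_seq => z; rewrite mem_nbrs => xz.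
by rewrite xz eq_sym (negPf (adj_neq xz)) degreeE.
Qed.

Lemma lazy_out (p : R) x z : z \notin x :: N x -> mu p x z = 0.
Proof.
by rewrite inE negb_or mem_nbrs /lazy_measure => /andP[/negPf-> /negPf->].
Qed.

Lemma dist_ge1 u v : u != v -> (1%:R%:E <= dist u v)%E.
Proof.
by move=> uv; apply: dist_ge => -[|//] [_ /= /eqP]; rewrite (negPf uv).
Qed.

Lemma dist_ge2 u v : u != v -> ~~ adj u v -> (2%:R%:E <= dist u v)%E.
Proof.
move=> uv auv; apply: dist_ge => -[|a [|//]] [/=].
  by move=> _ /eqP; rewrite (negPf uv).
by rewrite andbT => ua av; rewrite -av ua in auv.
Qed.

Lemma dist_ge3 u v : u != v -> ~~ adj u v -> ~~ share adj N u v ->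
  (3%:R%:E <= dist u v)%E.
Proof.
move=> uv auv /hasPn suv; apply: dist_ge => -[|a [|b [|//]]] [/=].
- by move=> _ /eqP; rewrite (negPf uv).
- by rewrite andbT => ua av; rewrite -av ua in auv.
case/and3P=> ua ab _ bv; have := suv a; rewrite mem_nbrs ua => /(_ isT).
by rewrite -bv adj_sym ab.
Qed.

Lemma sum_count (s : seq V) (a : pred V) :
  \sum_(z <- s) (a z)%:R = (count a s)%:R :> R.
Proof. by elim: s => [|z s IHs]; rewrite ?big_nil // big_cons IHs -natrD. Qed.

(** The potentials are 0 at [x], 1 at [y], -1 on [a], 2 on [b], and 0 resp. 1
    on the other neighbours of [x] resp. [y]. They differ by 3 only between [a]
    and [b], and pairs outside H are at distance 3. The resulting bound on the
    curvature is 1/d_x + 1/d_y minus the weight of the independent set; it is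
    stated with the denominators cleared. *)
Lemma flat_independent x y (a b : pred V) : adj x y ->
    (forall u v, u \in rem y (N x) -> v \in rem x (N y) -> a u -> b v ->
       ~~ share adj N u v) ->
  (size (N y) * count a (rem y (N x)) + size (N x) * count b (rem x (N y))
    <= size (N x) + size (N y))%N.
Proof.
move=> xy ind; have yx : adj y x by rewrite adj_sym.
have nxy := adj_neq xy.
have dx : (0 < size (N x))%N by rewrite (size_nbrs xy).
have dy : (0 < size (N y))%N by rewrite (size_nbrs yx).
set m := size (N x); set k := size (N y).
set A := count a _; set B := count b _.
have : 0 <= (1 - B%:R) / k%:R + (1 - A%:R) / m%:R :> R.
  apply: (slope_ge0 (adj_flat xy)) => p /andP[p0 p1].
  pose phi z : R := if z == x then 0 else if z == y then 1 else - (a z)%:R.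
  pose psi z : R := if z == y then 1 else if z == x then 0 else 1 + (b z)%:R.
  have un z : uniq (z :: N z) by rewrite /= mem_nbrs adj_irr nbrs_uniq.
  have -> : 1 - (1 - p) * ((1 - B%:R) / k%:R + (1 - A%:R) / m%:R) =
      \sum_(v <- y :: N y) mu p y v * psi v -
      \sum_(u <- x :: N x) mu p x u * phi u.
    rewrite !lazy_sum -/m -/k /phi /psi !eqxx.
    rewrite (perm_big _ (nbrs_rem yx)) (perm_big _ (nbrs_rem xy)).
    rewrite !big_cons !eqxx.
    rewrite (negPf nxy) eq_sym (negPf nxy).
    rewrite (eq_big_seq (fun z => 1 + (b z)%:R)); last first.
      move=> z; rewrite mem_rem_nbrs => /andP[/negPf-> yz].
      by rewrite eq_sym (negPf (adj_neq yz)).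
    rewrite [X in _ - (_ + _ * (_ + X))](eq_big_seq (fun z => - (a z)%:R));
      last first.
      move=> z; rewrite mem_rem_nbrs => /andP[/negPf-> yz].
      by rewrite eq_sym (negPf (adj_neq yz)).
    rewrite big_split /= sumrN !sum_count -/A -/B.
    rewrite -[\sum_(_ <- _) 1]/(\sum_(z <- rem x (N y)) (predT z)%:R) sum_count.
    rewrite count_predT.
    have -> : k%:R = 1 + (size (rem x (N y)))%:R :> R.
      by rewrite /k (size_nbrs yx) -[in LHS]add1n natrD.
    have s0 : 1 + (size (rem x (N y)))%:R != 0 :> R.
      by rewrite addrC natr1 pnatr_eq0.
    have m0 : m%:R != 0 :> R by rewrite pnatr_eq0 -lt0n.
    by field; rewrite s0 m0.
  apply: W1_ge => //; try exact: lazy_out.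
  have le (u v : V) (r : R) (n : nat) : r <= n%:R -> (n%:R%:E <= dist u v)%E ->
      (r%:E <= dist u v)%E.
    by move=> rn; apply: le_trans; rewrite lee_fin.
  have ind2 (c : bool) : c%:R <= 1 :> R by case: c.
  have yNb z : adj y z -> z != y by move=> yz; rewrite eq_sym adj_neq.
  have xNb z : adj x z -> z != x by move=> xz; rewrite eq_sym adj_neq.
  have tri1 z : adj x z -> ~~ adj z y.
    by move=> xz; apply/negP => zy; apply: (no_triangle xy xz); rewrite adj_sym.
  have tri2 z : adj y z -> ~~ adj x z.
    by move=> yz; apply/negP => xz; apply: (no_triangle xy xz).
  move=> u v; rewrite !inE !mem_nbrs /phi /psi.
  have [-> _|ux /= xu] := eqVneq u x.
    have [-> _|vy /= yv] := eqVneq v y.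
      by apply: (le _ _ _ 1%N); [rewrite subr0|apply: dist_ge1].
    have [vx|vx] := eqVneq v x.
      by apply: (le _ _ _ 0%N); [rewrite subr0|apply: dist_ge0].
    apply: (le _ _ _ 2%N); first by have := ind2 (b v); lra.
    by apply: dist_ge2; rewrite ?tri2 // eq_sym.
  have [uy|uy] := eqVneq u y.
    rewrite {u ux xu}uy; have [vy _|vy /= yv] := eqVneq v y.
      by apply: (le _ _ _ 0%N); [rewrite subrr|apply: dist_ge0].
    have [vx|vx] := eqVneq v x.
      by apply: (le _ _ _ 0%N); [lra|apply: dist_ge0].
    apply: (le _ _ _ 1%N); first by have := ind2 (b v); lra.
    by apply: dist_ge1; rewrite eq_sym.
  have [-> _|vy /= yv] := eqVneq v y.
    apply: (le _ _ _ 2%N); first by have := ind2 (a u); lra.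
    by apply: dist_ge2; rewrite ?tri1.
  have [->|vx] := eqVneq v x.
    apply: (le _ _ _ 1%N); first by have := ind2 (a u); lra.
    exact: dist_ge1.
  have uv : u != v by apply: contraNneq (tri2 _ yv) => <-.
  have auv : ~~ adj u v.
    apply: contra uy => uv'; apply/eqP; have xv : x != v by rewrite eq_sym.
    by apply: (no_square xv xu _ xy); rewrite adj_sym.
  case au : (a u); case bv : (b v); last first.
  - by apply: (le _ _ _ 2%N); [rewrite /=; lra|apply: dist_ge2].
  - by apply: (le _ _ _ 2%N); [rewrite /=; lra|apply: dist_ge2].
  - by apply: (le _ _ _ 2%N); [rewrite /=; lra|apply: dist_ge2].
  apply: (le _ _ _ 3%N); first by rewrite /=; lra.
  by apply: dist_ge3; rewrite ?ind // mem_rem_nbrs ?uy ?vx.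
have m0 : 0 < m%:R :> R by rewrite ltr0n.
have k0 : 0 < k%:R :> R by rewrite ltr0n.
have -> : (1 - B%:R) / k%:R + (1 - A%:R) / m%:R =
    ((m + k)%:R - (k * A + m * B)%:R) / (m%:R * k%:R) :> R.
  by rewrite !natrD !natrM; field; rewrite !gt_eqF.
by rewrite pmulr_lge0 ?invr_gt0 ?mulr_gt0 // subr_ge0 ler_nat.
Qed.

Lemma dist_refl x : (dist x x <= 0%:R%:E)%E.
Proof. exact: (@dist_le _ _ _ _ _ [::]). Qed.

Lemma dist_adj x y : adj x y -> (dist x y <= 1%:R%:E)%E.
Proof.
move=> xy; apply: (@dist_le _ _ _ _ _ [:: y]); split=> //=.
  by rewrite xy.
by rewrite inE adj_neq.
Qed.

Lemma dist_share x y : share adj N x y -> (dist x y <= 2%:R%:E)%E.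
Proof.
have [-> _|xy] := eqVneq x y.
  by apply: le_trans (dist_refl y) _; rewrite lee_fin ler_nat.
case/hasP=> w; rewrite mem_nbrs => xw yw; have wy : adj w y by rewrite adj_sym.
apply: (@dist_le _ _ _ _ _ [:: w; y]); split=> //=.
  by rewrite xw wy.
by rewrite !inE negb_or xy !adj_neq.
Qed.

Lemma no_cheap_plan x y (c : R) (plan : R -> seq (V * V * nat * R)) :
    adj x y -> 0 < c ->
    (forall p t, 2^-1 < p < 1 -> t \in plan p ->
      0 <= t.2 /\ (dist t.1.1.1 t.1.1.2 <= t.1.2%:R%:E)%E) ->
    (forall p, \sum_(t <- plan p) t.2 = 1) ->
    (forall p z, mu p x z = \sum_(t <- plan p) t.2 * (t.1.1.1 == z)%:R) ->
    (forall p z, mu p y z = \sum_(t <- plan p) t.2 * (t.1.1.2 == z)%:R) ->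
    (forall p, \sum_(t <- plan p) t.2 * t.1.2%:R = 1 - (1 - p) * c) ->
  False.
Proof.
move=> xy c0 wd w1 m1 m2 cost; suff : c <= 0 by rewrite leNgt c0.
apply: (slope_le0 (adj_flat xy)) => p pp.
rewrite -cost; apply: W1_le => //; rewrite ?w1 //.
- by move=> t /wd[].
- by move=> t /wd[].
Qed.

(** At a leaf [x], the neighbours of [y] other than [x] are served from [y],
    and [x] keeps as much mass as the measure at [y] gives it: the curvature is
    at least 2/d_y. *)
Lemma no_leaf x y : adj x y -> size (N x) != 1%N.
Proof.
move=> xy; apply/eqP => x1; have yx : adj y x by rewrite adj_sym.
have Nx : N x = [:: y].
  move: x1 (mem_nbrs x y); rewrite xy.
  by case: (N x) => [|a []] //= _; rewrite inE => /eqP ->.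
set d : R := (size (N y))%:R.
have d1 : 1 <= d by rewrite ler1n (size_nbrs yx).
pose plan p : seq (V * V * nat * R) :=
  let e := (1 - p) / d in
  [:: (x, x, 0%N, e); (x, y, 1%N, p - e); (y, y, 0%N, e)]
  ++ [seq (y, z, 1%N, e) | z <- rem x (N y)].
have szr : (size (rem x (N y)))%:R = d - 1.
  by rewrite /d (size_nbrs yx) -natr1 addrK.
have d0 : d != 0 by rewrite gt_eqF // (lt_le_trans _ d1).
have sumc (e : R) (s : seq V) : \sum_(z <- s) e = e * (size s)%:R.
  by rewrite big_const_seq count_predT iter_addr addr0 mulr_natr.
apply: (@no_cheap_plan x y (2 / d) plan) => //.
- by rewrite divr_gt0 // (lt_le_trans _ d1).
- move=> p t /andP[p2 p1].
  have [e0 ep] : 0 <= (1 - p) / d /\ (1 - p) / d <= p.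
    split; first by rewrite divr_ge0 ?(le_trans _ d1) // subr_ge0 ltW.
    rewrite ler_pdivrMr ?(lt_le_trans _ d1) //.
    apply: (@le_trans _ _ p); first lra.
    by rewrite ler_peMr //; lra.
  rewrite mem_cat !inE => /orP[/or3P[]/eqP->|/mapP[z + ->]] /=.
  + by split=> //; exact: dist_refl.
  + by rewrite subr_ge0; split=> //; exact: dist_adj.
  + by split=> //; exact: dist_refl.
  by rewrite mem_rem_nbrs => /andP[_ yz]; split=> //; exact: dist_adj.
- move=> p; rewrite big_cat big_map !big_cons big_nil /= sumc szr.
  by field.
- move=> p z; rewrite big_cat big_map !big_cons big_nil /= sumc szr.
  by rewrite lazy_measureE Nx big_seq1 /=; field.
- move=> p z; rewrite big_cat big_map !big_cons big_nil /= lazy_measureE -/d.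
  by rewrite (perm_big _ (nbrs_rem yx)) big_cons /= -mulr_sumr; ring.
move=> p; rewrite big_cat big_map !big_cons big_nil /= sumc szr.
by field.
Qed.

(** On a pentagon the mass at [a] can go directly to [b], at distance 2: the
    curvature is at least 1/2. *)
Lemma two_two_no_pentagon x y a b : adj x y -> perm_eq (N x) [:: y; a] ->
  perm_eq (N y) [:: x; b] -> ~~ share adj N a b.
Proof.
move=> xy Nx Ny; apply/negP=> ab; have yx : adj y x by rewrite adj_sym.
pose plan p : seq (V * V * nat * R) :=
  let q := (1 - p) / 2 in
  [:: (x, x, 0%N, q); (x, y, 1%N, p - q); (y, y, 0%N, q); (a, b, 2%N, q)].
apply: (@no_cheap_plan x y (1 / 2) plan) => //.
- move=> p t /andP[p2 p1].
  have [e0 ep] : 0 <= (1 - p) / 2 /\ (1 - p) / 2 <= p by split; lra.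
  rewrite !inE => /or4P[]/eqP-> /=.
  + by split=> //; exact: dist_refl.
  + by rewrite subr_ge0; split=> //; exact: dist_adj.
  + by split=> //; exact: dist_refl.
  by split=> //; exact: dist_share.
- by move=> p; rewrite !big_cons big_nil /=; field.
- move=> p z; rewrite lazy_measureE (perm_size Nx) (perm_big _ Nx).
  rewrite !big_cons !big_nil /=.
  by field.
- move=> p z; rewrite lazy_measureE (perm_size Ny) (perm_big _ Ny).
  rewrite !big_cons !big_nil /=.
  by field.
by move=> p; rewrite !big_cons big_nil /=; field.
Qed.

(** The target masses at [b] and [c] come from [a], at distance 2, for 3/4 and
    from [y] for 1/4: the curvature is at least 1/6. *)
Lemma two_three_one_pentagon x y a b c : adj x y -> perm_eq (N x) [:: y; a] ->
  perm_eq (N y) [:: x; b; c] -> ~~ (share adj N a b && share adj N a c).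
Proof.
move=> xy Nx Ny; apply/negP=> /andP[ab ac].
have yx : adj y x by rewrite adj_sym.
have [yb yc] : adj y b /\ adj y c.
  by rewrite -!mem_nbrs !(perm_mem Ny) !inE !eqxx !orbT.
pose plan p : seq (V * V * nat * R) :=
  (* 12 is a common denominator of the masses 1/3, 1/4 and 1/12 *)
  let q := (1 - p) / 12 in
  [:: (x, x, 0%N, 4 * q); (x, y, 1%N, p - 4 * q); (y, y, 0%N, 4 * q);
      (y, b, 1%N, q); (y, c, 1%N, q); (a, b, 2%N, 3 * q); (a, c, 2%N, 3 * q)].
apply: (@no_cheap_plan x y (1 / 6) plan) => //.
- move=> p t /andP[p2 p1].
  set q := (1 - p) / 12; have [e0 ep] : 0 <= q /\ 4 * q <= p.
    by rewrite /q; split; lra.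
  have e3 : 0 <= 3 * q by lra.
  have e4 : 0 <= 4 * q by lra.
  rewrite !inE => /orP[|/orP[|/orP[|/or4P[]]]] /eqP-> /=; split;
    rewrite ?subr_ge0 //;
    by [exact: dist_refl|exact: dist_adj|exact: dist_share].
- by move=> p; rewrite !big_cons big_nil /=; field.
- move=> p z; rewrite lazy_measureE (perm_size Nx) (perm_big _ Nx).
  rewrite !big_cons !big_nil /=.
  by field.
- move=> p z; rewrite lazy_measureE (perm_size Ny) (perm_big _ Ny).
  rewrite !big_cons !big_nil /=.
  by field.
by move=> p; rewrite !big_cons big_nil /=; field.
Qed.

Section Connected.
Local Open Scope nat_scope.
Hypotheses (adj_conn : graph_connected adj) (adj_edge : exists x y, adj x y).

Lemma exists_nbr x : exists y, adj x y.
Proof.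
have [a [b ab]] := adj_edge; have [[|y s] [/= ps ls _]] := adj_conn x a.
  by exists b; rewrite ls.
by exists y; case/andP: ps.
Qed.

Lemma degree_ge2 x : 1 < size (N x).
Proof.
have [y xy] := exists_nbr x; have := no_leaf xy.
by rewrite (size_nbrs xy); case: size.
Qed.

(** All remaining neighbours of [y] form an independent set. *)
Lemma degree_pair x y : adj x y ->
  size (N x) * (size (N y)).-1 <= size (N x) + size (N y).
Proof.
move=> xy; have yx : adj y x by rewrite adj_sym.
have /= := @flat_independent x y pred0 predT xy.
rewrite count_pred0 count_predT muln0 add0n.
by rewrite (size_nbrs yx) /=; apply => ? ? ? ?.
Qed.

Lemma degree_le4 x : size (N x) <= 4.
Proof.
have [y xy] := exists_nbr x; have yx : adj y x by rewrite adj_sym.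
by have := degree_pair yx; have := degree_ge2 y; nia.
Qed.

Lemma degree4_nbr x y : size (N x) = 4 -> adj x y -> size (N y) = 2.
Proof.
move=> x4 xy; have yx : adj y x by rewrite adj_sym.
by have := degree_pair yx; have := degree_ge2 y; rewrite x4; nia.
Qed.

(** The neighbours of [y] have degree 2; let [z u] be the other neighbour of
    [u]. Independent sets force [z u] to be adjacent to [z v] for at least two
    of the other neighbours [v] of [y]. But a graph with four vertices and
    minimum degree 2 contains a triangle or a square. *)
Lemma degree_neq4 y : size (N y) != 4.
Proof.
apply/eqP => y4.
have [z zP] : exists z : V -> V, forall u, adj y u ->
    rem y (N u) = [:: z u] /\ adj u (z u) /\ z u != y.
  exists (fun u => head y (rem y (N u))) => u yu.
  have uy : adj u y by rewrite adj_sym.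
  have := degree4_nbr y4 yu; rewrite (size_nbrs uy).
  case E : (rem y (N u)) => [|w []] //= _.
  have : w \in rem y (N u) by rewrite E inE eqxx.
  by rewrite mem_rem_nbrs => /andP[].
have z_inj u v : adj y u -> adj y v -> u != v -> z u != z v.
  move=> yu yv uv; have [_ [uz zy]] := zP u yu; have [_ [vz _]] := zP v yv.
  apply: contra zy => /eqP zuv; apply/eqP.
  by apply: (no_square uv uz) => //;
    rewrite ?zuv // adj_sym.
have few u : adj y u ->
    count (fun v => ~~ adj (z u) (z v)) (rem u (N y)) <= 1.
  move=> yu; have uy : adj u y by rewrite adj_sym.
  have [Nu [uz zy]] := zP u yu.
  have := @flat_independent u y predT (fun v => ~~ adj (z u) (z v)) uy.
  rewrite Nu y4 (degree4_nbr y4 yu) /= => ind.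
  suff : 4 * (1 + 0) +
      2 * count (fun v => ~~ adj (z u) (z v)) (rem u (N y)) <= 2 + 4.
    by lia.
  apply: ind => w v; rewrite inE => /eqP-> {w}.
  rewrite mem_rem_nbrs => /andP[vu yv] _.
  apply: contra => /hasP[w]; rewrite mem_nbrs => zw vw.
  have : w \in y :: rem y (N v).
    by rewrite -(perm_mem (nbrs_rem _)) ?mem_nbrs // adj_sym.
  have [-> _] := zP v yv; rewrite !inE => /orP[]/eqP ew; last by rewrite -ew.
  case: (no_triangle uy uz).
  by rewrite -ew adj_sym.
move: y4 few z_inj (nbrs_uniq y) (mem_nbrs y).
case: (N y) => [|a [|b [|c [|d []]]]] // _ few z_inj.
rewrite /= !inE !negb_or.
move=> /andP[/and3P[ab ac ad] /andP[/andP[bc bd] /andP[cd _]]] mN.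
have [ya yb yc yd] : [/\ adj y a, adj y b, adj y c & adj y d].
  by rewrite -!mN !inE !eqxx !orbT.
have := few a ya; have := few b yb; have := few c yc; have := few d yd.
rewrite /= !eqxx (negPf ab) (negPf ac) (negPf ad).
rewrite (negPf bc) (negPf bd) (negPf cd).
have tri u v w : ~~ [&& adj (z u) (z v), adj (z u) (z w) & adj (z v) (z w)].
  by apply/and3P => -[]; apply: (no_triangle).
have sq s t u v : adj y s -> adj y t -> adj y u -> adj y v ->
    s != t -> u != v ->
    ~~ [&& adj (z s) (z u), adj (z t) (z u), adj (z s) (z v) & adj (z t) (z v)].
  move=> ys yt yu yv st uv; apply/and4P => -[su tu sv tv].
  have /eqP := no_square (z_inj _ _ ys yt st) su tu sv tv.
  by apply/negP/z_inj.
have := tri a b c; have := tri a b d; have := tri a c d; have := tri b c d.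
have := sq a b c d ya yb yc yd ab cd.
have := sq a c b d ya yc yb yd ac bd.
have := sq a d b c ya yd yb yc ad bc.
rewrite /= ?(adj_sym (z b) (z a)) ?(adj_sym (z c) (z a)) ?(adj_sym (z d) (z a)).
rewrite ?(adj_sym (z c) (z b)) ?(adj_sym (z d) (z b)) ?(adj_sym (z d) (z c)).
by do 6![case: (adj (z _) (z _))].
Qed.

Lemma degree_lt4 x : 1 < size (N x) < 4.
Proof. by rewrite degree_ge2 ltn_neqAle degree_neq4 degree_le4. Qed.

Lemma flat_pair_nbrs x y : adj x y ->
  flat_pair (share adj N) (share adj N) (rem y (N x)) (rem x (N y)).
Proof.
wlog le : x y / size (N x) <= size (N y).
  move=> wl xy; case: (leqP (size (N x)) (size (N y))) => [|/ltnW] le.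
    exact: wl.
  rewrite flat_pairC; last exact: share_sym mem_nbrs.
  by apply: wl; rewrite // adj_sym.
move=> xy; have yx : adj y x by rewrite adj_sym.
have Nx := nbrs_rem xy; have Ny := nbrs_rem yx.
have un u v : uniq (rem u (N v)) by apply/rem_uniq/nbrs_uniq.
have ind := fun a b => @flat_independent x y a b xy.
have /= := degree_lt4 x; have := degree_lt4 y; move: le ind (un x y) (un y x).
rewrite (perm_size Nx) (perm_size Ny) /=; move: Nx Ny.
case: (rem y _) => [|a [|b []]] //; case: (rem x _) => [|c [|d []]] //;
  move=> Nx Ny _ ind /= uY uX _ _.
- exact: (two_two_no_pentagon xy Nx Ny).
- rewrite (two_three_one_pentagon xy Nx Ny) /=.
  have H u v : u \in [:: a] -> v \in [:: c; d] -> predT u ->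
      ~~ share adj N a v -> ~~ share adj N u v by rewrite inE => /eqP->.
  have := ind _ _ H; rewrite /=.
  by case: (share adj N a c); case: (share adj N a d).
(* on two plus two vertices, Hall's condition amounts to the absence of
   isolated vertices in H *)
move: uX uY; rewrite !inE !andbT => ab cd.
have Hl e : e \in [:: a; b] -> share adj N e c || share adj N e d.
  move=> eX; apply/negPn; rewrite negb_or; apply/negP => /andP[ec ed].
  have H u v : u \in [:: a; b] -> v \in [:: c; d] -> pred1 e u ->
      predT v -> ~~ share adj N u v.
    by move=> _; rewrite !inE => /orP[]/eqP-> /eqP-> _.
  by have := ind _ _ H; rewrite (count_uniq_mem e) ?eX //= inE ab.
have Hr e : e \in [:: c; d] -> share adj N a e || share adj N b e.
  move=> eY; apply/negPn; rewrite negb_or; apply/negP => /andP[ae be].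
  have H u v : u \in [:: a; b] -> v \in [:: c; d] -> predT u ->
      pred1 e v -> ~~ share adj N u v.
    by rewrite !inE => /orP[]/eqP-> _ _ /eqP->.
  by have := ind _ _ H; rewrite (count_uniq_mem e) ?eY //= inE cd.
have := Hl a; have := Hl b; have := Hr c; have := Hr d.
rewrite !inE !eqxx !orbT => /(_ isT) h1 /(_ isT) h2 /(_ isT) h3 /(_ isT).
move: h1 h2 h3; by do 4![case: (share adj N _ _)].
Qed.

Lemma flat_locally_flat : locally_flat adj N.
Proof.
split=> //.
- exact: mem_nbrs.
- exact: nbrs_uniq.
- exact: degree_lt4.
- exact: (no_triangle).
- exact: (no_square).
exact: flat_pair_nbrs.
Qed.

End Connected.
End FlatGraph.

(** * Finite graphs given by tables of neighbours *)

Section Tables.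
Local Open Scope nat_scope.

Implicit Types (t : seq (seq nat)).

Definition table_graph t : rel 'I_(size t) :=
  fun i j => (j : nat) \in nth [::] t i.

Lemma graph_iso_sym (V W : Type) (r : rel V) (r' : rel W) :
  graph_iso r r' -> graph_iso r' r.
Proof.
move=> [f [g fK gK] rf]; exists g; first by exists f.
by move=> x y; rewrite rf !gK.
Qed.

Lemma graph_iso_trans (V W U : Type) (r : rel V) (r' : rel W) (r'' : rel U) :
  graph_iso r r' -> graph_iso r' r'' -> graph_iso r r''.
Proof.
move=> [f bf rf] [g bg rg]; exists (g \o f); first exact: bij_comp.
by move=> x y; rewrite rf rg.
Qed.

(** Whether the partial map [sigma], defined below its length [k], may be
    extended by [k |-> c]. The default value [c] of [nth] stands for the image
    of [k] itself, so that the test includes the pair [(k, k)]. *)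
Definition consistent t1 t2 (sigma : seq nat) (c : nat) : bool :=
  let k := size sigma in
  if c \in sigma then false else
  all (fun j =>
    ((j \in nth [::] t1 k) == (nth c sigma j \in nth [::] t2 c)) &&
    ((k \in nth [::] t1 j) == (c \in nth [::] t2 (nth c sigma j))))
    (iota 0 k.+1).

(** Under call by value, [has] would explore all the extensions of a partial
    isomorphism; the conditional stops at the first success. *)
Fixpoint lazy_has (T : Type) (p : pred T) (l : seq T) : bool :=
  if l is x :: l' then if p x then true else lazy_has p l' else false.

Fixpoint extends_to_iso t1 t2 (fuel : nat) (sigma : seq nat) : bool :=
  if fuel is k.+1 then
    lazy_has (fun c => if consistent t1 t2 sigma c
                  then extends_to_iso t1 t2 k (rcons sigma c) else false)
      (iota 0 (size t2))
  else true.

Definition isomorphic t1 t2 : bool :=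
  if size t1 == size t2 then extends_to_iso t1 t2 (size t1) [::] else false.

Lemma consistentP t1 t2 (sigma : seq nat) c :
  consistent t1 t2 sigma c ->
  let s' := rcons sigma c in let k := size sigma in
  c \notin sigma /\ forall j, j <= k ->
    ((j \in nth [::] t1 k) = (nth 0 s' j \in nth [::] t2 (nth 0 s' k))) /\
    ((k \in nth [::] t1 j) = (nth 0 s' k \in nth [::] t2 (nth 0 s' j))).
Proof.
rewrite /consistent; case: ifPn => // cs /allP cons; split=> // j jk.
have jm : j \in iota 0 (size sigma).+1 by rewrite mem_iota add0n ltnS.
have /andP[/eqP -> /eqP ->] := cons j jm.
rewrite !nth_rcons ltnn eqxx.
case: ltngtP jk => // [jk _|-> _].
  by rewrite (set_nth_default c) // .
by rewrite nth_default.
Qed.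

Definition partial_iso t1 t2 (sigma : seq nat) :=
  [/\ uniq sigma, forall c, c \in sigma -> c < size t2
    & forall i j, i < size sigma -> j < size sigma ->
      (j \in nth [::] t1 i) = (nth 0 sigma j \in nth [::] t2 (nth 0 sigma i))].

Lemma lazy_hasE (T : Type) (p : pred T) l : lazy_has p l = has p l.
Proof. by elim: l => //= x l ->. Qed.

Lemma extends_to_isoP t1 t2 k sigma :
  extends_to_iso t1 t2 k sigma -> partial_iso t1 t2 sigma ->
  exists2 sigma', size sigma' = size sigma + k & partial_iso t1 t2 sigma'.
Proof.
elim: k sigma => [|k IHk] sigma /=; first by exists sigma; rewrite ?addn0.
rewrite lazy_hasE => /hasP[c]; rewrite mem_iota => /= ct2.
case: ifP => // /consistentP /= [cN cons] ext [us ls ms].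
have [|sigma' ss' ps'] := IHk _ ext.
  split=> [|d|i j].
  - by rewrite rcons_uniq cN.
  - by rewrite mem_rcons inE => /orP[/eqP->|/ls].
  rewrite size_rcons !ltnS.
  case: (ltngtP i (size sigma)) => // [ilt|->] _; last by move=> /cons[].
  case: (ltngtP j (size sigma)) => // [jlt|->] _.
    by rewrite ms // !nth_rcons ilt jlt.
  by have [] := cons i (ltnW ilt).
by exists sigma'; rewrite // ss' size_rcons addSnnS.
Qed.

Lemma isomorphicP t1 t2 :
  isomorphic t1 t2 -> graph_iso (@table_graph t1) (@table_graph t2).
Proof.
rewrite /isomorphic; case: eqP => // st /extends_to_isoP[|s ss [us ls ms]].
  by split.
rewrite add0n in ss.
have lt (i : 'I_(size t1)) : nth 0 s i < size t2 by rewrite ls ?mem_nth ?ss.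
pose f i := Ordinal (lt i).
exists f; last by move=> i j; rewrite /table_graph ms ?ss.
apply: inj_card_bij; last by rewrite !card_ord st.
by move=> i j [] /eqP; rewrite nth_uniq ?ss // => /eqP/val_inj.
Qed.

End Tables.

(** * Graphs all of whose degrees are two *)

Section TwoRegular.
Variables (V : choiceType) (adj : rel V) (N : V -> seq V) (x0 : V).
Hypotheses (lf : locally_flat adj N) (conn : graph_connected adj).
Hypothesis deg2 : forall x, size (N x) = 2%N.

Definition onward (x y : V) : V := head y (rem x (N y)).

Lemma onwardP x y : adj x y ->
  [/\ rem x (N y) = [:: onward x y], onward x y != x, adj y (onward x y)
    & forall z, adj y z -> z = x \/ z = onward x y].
Proof.
rewrite (lf_sym lf) -(lf_nbrs lf) => xy.
have : size (rem x (N y)) = 1%N by rewrite size_rem // deg2.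
rewrite /onward; case E: (rem x (N y)) => [|o []] //= _.
have : o \in rem x (N y) by rewrite E inE eqxx.
rewrite mem_rem_uniq ?(lf_uniq lf) // inE (lf_nbrs lf) => /andP[ox yo].
split=> // z; rewrite -(lf_nbrs lf) (perm_mem (perm_to_rem xy)) E !inE.
by move=> /orP[]/eqP->; [left|right].
Qed.

Fixpoint walk (x y : V) (n : nat) : V :=
  if n is m.+1 then walk y (onward x y) m else x.

(** [a - b - c] is a path without folding, and [b] has no further neighbour. *)
Definition threads (a b c : V) : Prop :=
  [/\ a != c, adj b a, adj b c & forall z, adj b z -> z = a \/ z = c].

Lemma threadsC a b c : threads a b c -> threads c b a.
Proof.
case=> ac ba bc abc; split=> [||//|z /abc[]]; rewrite 1?eq_sym //.
  by right.
by left.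
Qed.

Lemma walkP x y n : adj x y ->
  threads (walk x y n) (walk x y n.+1) (walk x y n.+2).
Proof.
elim: n x y => [|n IHn] x y xy /=; have [_ ox yo oz] := onwardP xy.
  by split=> //; rewrite 1?eq_sym // (lf_sym lf).
exact: IHn.
Qed.

(** The line consists of two walks started on the edge [x0 x1] in opposite
    directions. The backward one starts at [x1] as well, so that its index 2 is
    the position -1 of the line. *)
Lemma line_exists : exists f : int -> V,
  forall i : int, threads (f (i - 1)) (f i) (f (i + 1)).
Proof.
have [x1 x01] : exists y, adj x0 y.
  case: (N x0) (deg2 x0) (lf_nbrs lf x0) => // y ? _ ny.
  by exists y; rewrite -ny inE eqxx.
have x10 : adj x1 x0 by rewrite (lf_sym lf).
exists (fun i => match i with Posz n => walk x0 x1 n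
                            | Negz n => walk x1 x0 n.+2 end).
case=> [[|n]|n].
- exact/threadsC/(walkP 0 x10).
- have -> : Posz n.+1 - 1 = n by lia.
  have -> : Posz n.+1 + 1 = n.+2 by lia.
  exact: walkP.
have -> : Negz n - 1 = Negz n.+1 by lia.
apply: threadsC; case: n => [|n].
  exact: (walkP 1 x10).
have -> : Negz n.+1 + 1 = Negz n by lia.
exact: (walkP n.+2 x10).
Qed.

Section Line.
Variable f : int -> V.
Hypothesis fP : forall i : int, threads (f (i - 1)) (f i) (f (i + 1)).

Lemma line_next (i : int) : adj (f i) (f (i + 1)).
Proof. by have [] := fP i. Qed.

Lemma line_prev (i : int) : adj (f i) (f (i - 1)).
Proof. by have [] := fP i. Qed.

Lemma line_nbr (i : int) z : adj (f i) z -> z = f (i - 1) \/ z = f (i + 1).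
Proof. by have [_ _ _] := fP i; apply. Qed.

Lemma line_surj x : exists i, f i = x.
Proof.
have [p [pp <- _]] := conn (f 0) x; elim: p (0 : int) pp => [|y p IHp] i /=.
  by exists i.
by case/andP=> /line_nbr[]-> /IHp.
Qed.

Lemma injective_line_iso : injective f -> graph_iso adj infinite_path.
Proof.
move=> fI; apply: graph_iso_sym; exists f.
  pose g x := projT1 (cid (line_surj x)).
  have gK : cancel g f by move=> x; rewrite /g; case: cid.
  by exists g => // i; apply: fI; rewrite gK.
move=> i j; apply/idP/idP => [/orP[]/eqP->|/line_nbr[]/fI->].
- exact: line_next.
- by rewrite -[X in adj _ (f X)](addrK 1) (lf_sym lf) addrK line_next.
- by rewrite /infinite_path /undirected subrK eqxx orbT.
by rewrite /infinite_path /undirected eqxx.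
Qed.

Section Period.
Variable n : nat.
Hypothesis n_gt0 : (0 < n)%N.
Hypothesis n_min :
  forall m : nat, (0 < m < n)%N -> forall i : int, f (i + m%:Z) != f i.

Lemma line_gap1 (i : int) : f (i + 1) != f i.
Proof. by rewrite eq_sym (adj_neq (lf_irr lf)) ?line_next. Qed.

Lemma line_gap2 (i : int) : f (i + 2) != f i.
Proof.
have [+ _ _ _] := fP (i + 1); rewrite addrK eq_sym.
by rewrite (_ : i + 1 + 1 = i + 2); last lia.
Qed.

(** A fold at a return after [n] steps would give a return after [n - 2] steps.
    *)
Lemma no_fold (i : int) : f (i + n%:Z) = f i -> f (i + n%:Z - 1) != f (i + 1).
Proof.
move=> fin; case: n n_gt0 n_min fin => [|[|[|m]]] // _ nm fin.
- by rewrite addrK eq_sym line_gap1.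
- by case/eqP: (line_gap2 i).
have -> : i + Posz m.+3 - 1 = (i + 1) + Posz m.+1 by lia.
by apply: nm; lia.
Qed.

Lemma period_up (i : int) : f (i + n%:Z) = f i -> f (i + 1 + n%:Z) = f (i + 1).
Proof.
move=> fin; have := line_next i; rewrite -fin => /line_nbr[fe|->].
  by case/eqP: (no_fold fin).
by congr f; lia.
Qed.

Lemma period_down (i : int) :
  f (i + n%:Z) = f i -> f (i - 1 + n%:Z) = f (i - 1).
Proof.
move=> fin; have := line_prev (i + n); rewrite fin => /line_nbr[<-|fe].
  by congr f; lia.
by have := no_fold fin; rewrite fe eqxx.
Qed.

Variable i0 : int.
Hypothesis fi0 : f (i0 + n%:Z) = f i0.

Lemma periodic (i : int) : f (i + n%:Z) = f i.
Proof.
rewrite -(subrK i0 i); move: (i - i0).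
elim/int_rec => [|m IHm|m IHm]; first by rewrite add0r.
- rewrite (_ : Posz m.+1 + i0 = m%:Z + i0 + 1); last lia.
  exact: period_up.
rewrite (_ : - Posz m.+1 + i0 = - m%:Z + i0 - 1); last lia.
exact: period_down.
Qed.

Lemma periodicM (i : int) (q : int) : f (i + q * n%:Z) = f i.
Proof.
elim/int_rec: q => [|m IHm|m IHm]; first by rewrite mul0r addr0.
- rewrite (_ : i + Posz m.+1 * n = i + m%:Z * n + n); last by lia.
  by rewrite periodic.
rewrite -(periodic (i + _)) -IHm; congr f; lia.
Qed.

Lemma line_mod (a b : nat) : f a = f b <-> a = b %[mod n].
Proof.
have fmod (k : nat) : f k = f (k %% n)%N.
  by rewrite {1}(divn_eq k n) addnC PoszD PoszM periodicM.
split=> [|e]; last by rewrite fmod e -fmod.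
rewrite (fmod a) (fmod b).
have := ltn_pmod a n_gt0; have := ltn_pmod b n_gt0.
move: (a %% n)%N (b %% n)%N => {}a {}b.
wlog ab : a b / (a <= b)%N => [wl bn an e|bn an e].
  by case: (leqP a b) => [/wl|/ltnW/wl h]; [apply|apply/esym/h].
apply/eqP; rewrite eqn_leq ab /=; case: ltnP => // ltab.
have : f (a%:Z + (b - a)%N%:Z) != f a by apply: n_min; lia.
by rewrite -PoszD subnKC // e eqxx.
Qed.

Lemma line_rem_next (i : int) : rem (f (i + 1)) (N (f i)) = [:: f (i - 1)].
Proof.
have ii : adj (f (i + 1)) (f i) by rewrite (lf_sym lf) line_next.
have [-> on io _] := onwardP ii.
by case/line_nbr: io on => [->|->]; rewrite ?eqxx.
Qed.

Lemma line_rem_prev (i : int) : rem (f (i - 1)) (N (f i)) = [:: f (i + 1)].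
Proof.
have ii : adj (f (i - 1)) (f i) by rewrite (lf_sym lf) line_prev.
have [-> on io _] := onwardP ii.
by case/line_nbr: io on => [->|->]; rewrite ?eqxx.
Qed.

(** Periods 1 and 2 contradict the absence of loops and folds, 3 and 4 the
    girth, and 5 the local condition, which forbids pentagons here. *)
Lemma period_ge6 : (6 <= n)%N.
Proof.
have p (i j : int) : j = i + n -> f i = f j by move=> ->; rewrite periodic.
have f01 : adj (f 0) (f 1) := line_next 0.
have f12 : adj (f 1) (f 2) := line_next 1.
have f23 : adj (f 2) (f 3) := line_next 2.
have f34 : adj (f 3) (f 4) := line_next 3.
case: n n_gt0 p => [|[|[|[|[|[|m]]]]]] // _ p.
- by case/eqP: (line_gap1 0); apply/esym/p.
- by case/eqP: (line_gap2 0); apply/esym/p.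
- have f02 : adj (f 0) (f 2) by rewrite (p 0 3) // (lf_sym lf).
  by case: (lf_triangle lf f01 f02 f12).
- have f02 : f 0 != f 2 by rewrite eq_sym (line_gap2 0).
  have f03 : adj (f 0) (f 3) by rewrite (p 0 4) // (lf_sym lf).
  have f21 : adj (f 2) (f 1) by rewrite (lf_sym lf).
  by case/eqP: (line_gap2 1); apply/esym/(lf_square lf f02 f01 f21 f03 f23).
have := lf_flat lf f01; rewrite -[f 1]/(f (0 + 1)) line_rem_next.
have -> : rem (f 0) (N (f (0 + 1))) = [:: f 2] := line_rem_prev 1.
move=> /negP[]; apply/hasP.
exists (f 3) => //.
by rewrite (p (0 - 1) 4) // (lf_nbrs lf) (lf_sym lf).
Qed.

Lemma periodic_line_iso : graph_iso adj (@cycle_graph n).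
Proof.
apply: graph_iso_sym; exists (fun k : 'I_n => f (k : nat)).
  have gP x : exists k : 'I_n, f (k : nat) = x.
    have [i <-] := line_surj x.
    have lt : (`|(i %% n)%Z| < n)%N by have := ltz_pmod i (d := n); lia.
    exists (Ordinal lt) => /=.
    rewrite [in RHS](divz_eq i n) addrC periodicM; congr f.
    by have := modz_ge0 i (d := n); lia.
  exists (fun x => projT1 (cid (gP x))) => [k|x]; last by case: cid.
  case: cid => l /= /line_mod; rewrite !modn_small // => /val_inj.
  exact.
have next (a b : nat) : (b < n)%N -> f b = f (a%:Z + 1) <-> b = (a.+1 %% n)%N.
  by move=> bn; rewrite -PoszD addn1 line_mod (modn_small bn).
move=> k l; apply/idP/idP => [/orP[/eqP lk|/eqP kl]|/line_nbr[fl|fl]].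
- by rewrite ((next _ _ (ltn_ord l)).2 lk) line_next.
- by rewrite (lf_sym lf) ((next _ _ (ltn_ord k)).2 kl) line_next.
- apply/orP; right; apply/eqP/next; first by [].
  have : f l = f (k + n.-1)%N by rewrite fl -periodic; congr f; lia.
  move/line_mod => e; rewrite -PoszD; apply/line_mod.
  by rewrite -modnDml e modnDml -addnA addn1 prednK // modnDr.
by apply/orP; left; apply/eqP/next.
Qed.

End Period.

(** The period is the least number of steps after which the line returns to
    some vertex. *)
Lemma line_iso : graph_iso adj infinite_path
  \/ exists2 n : nat, (6 <= n)%N & graph_iso adj (@cycle_graph n).
Proof.
pose returns (n : nat) :=
  (0 < n)%N && `[< exists i : int, f (i + n%:Z) = f i >].
have [[n rn]|nr] := pselect (exists n, returns n); last first.
  left; apply: injective_line_iso => i j fij.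
  wlog ij : i j fij / i <= j.
    by case: (leP i j) => [ij|/ltW ij] wl; [|symmetry]; apply: wl.
  apply/eqP; rewrite eq_le ij /=; case: leP => // ltij; case: nr.
  exists `|j - i|%N; apply/andP; split; first by lia.
  by apply/asboolP; exists i; rewrite fij; congr f; lia.
right; have := @ex_minnP returns (ex_intro _ n rn).
case: ex_minnP => {n rn} n /andP[n0 /asboolP[i fi]] nm.
have n_min (m : nat) : (0 < m < n)%N -> forall j : int, f (j + m%:Z) != f j.
  move=> /andP[m0 mn] j; apply/eqP => fj.
  have : returns m by apply/andP; split=> //; apply/asboolP; exists j.
  by move/nm; rewrite leqNgt mn.
by exists n; [apply: period_ge6 fi|apply: periodic_line_iso fi].
Qed.

End Line.

Lemma two_regular_iso : graph_iso adj infinite_path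
  \/ exists2 n : nat, (6 <= n)%N & graph_iso adj (@cycle_graph n).
Proof. by have [f fP] := line_exists; apply: line_iso fP. Qed.

End TwoRegular.

(** * Search through partial graphs *)

Section PartialGraphs.
Local Open Scope nat_scope.

(** For each vertex, its known neighbours and a flag telling that it has no
    others. Adjacency between vertices that are not flagged is undecided unless
    it is listed. *)
Definition partial_graph := seq (seq nat * bool).

Implicit Types (s : partial_graph) (t : seq (seq nat)).

Definition nb s (i : nat) : seq nat := nth [::] (unzip1 s) i.

Definition flagged s (i : nat) : bool := nth false (unzip2 s) i.

(** Degrees do not exceed 3, so three known neighbours are all. *)
Definition full s (i : nat) : bool := flagged s i || (2 < size (nb s i)).

Definition well_formed s : bool :=
  all (fun i => uniq (nb s i) &&
         all (fun j => (j < size s) && (i \in nb s j)) (nb s i))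
    (iota 0 (size s)).

Definition common s (u v : nat) : bool :=
  has (fun w => w \in nb s v) (nb s u).

(** If this holds, every path of length two from [u] is known. *)
Definition explored s (u : nat) : bool := full s u && all (full s) (nb s u).

Definition maybe_common s (u v : nat) : bool :=
  common s u v
  || ~~ [|| explored s u, explored s v | full s u && full s v].

Definition admissible s : bool :=
  all (fun i => all (fun j =>
    [&& ~~ common s i j,
        all (fun k => (j == k) ||
               ~~ has (fun l => (l != i) && (l \in nb s k)) (nb s j)) (nb s i)
      & full s i ==> full s j ==>
        flat_pair (common s) (maybe_common s)
          (rem j (nb s i)) (rem i (nb s j))])
    (nb s i)) (iota 0 (size s)).

Definition candidates s (v : nat) : seq nat :=
  [seq j <- iota 0 (size s) | [&& j != v, j \notin nb s v & ~~ full s j]].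

(** The search expands the first of these; preferring a vertex with two known
    neighbours keeps the tree small. *)
Definition open_vertices s : seq nat :=
  let op := [seq i <- iota 0 (size s) | ~~ full s i] in
  [seq i <- op | size (nb s i) == 2] ++ op.

(** [S] is the set of old vertices and [m] the number of new vertices that [v]
    gets as neighbours. *)
Definition extend s (v : nat) (S : seq nat) (m : nat) : partial_graph :=
  [seq if i == v then (nb s v ++ S ++ iota (size s) m, true)
       else if i \in S then (v :: nb s i, flagged s i)
       else (nb s i, flagged s i) | i <- iota 0 (size s)]
  ++ nseq m ([:: v], false).

Fixpoint short_subseqs (T : Type) (k : nat) (l : seq T) : seq (seq T) :=
  match k, l with
  | k'.+1, x :: l' =>
      [seq x :: r | r <- short_subseqs k' l'] ++ short_subseqs k l'
  | _, _ => [:: [::]]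
  end.

(** Exploration of the tree of partial graphs rooted at [s], [true] meaning
    that every leaf is either contradictory or a graph of the list. Symmetry of
    the neighbour lists is tested at each node, which costs little and spares a
    proof that [extend] preserves it. *)
Fixpoint search (tables : seq (seq (seq nat))) (fuel : nat) s : bool :=
  if ~~ well_formed s then false else
  if ~~ admissible s then true else
  match open_vertices s, fuel with
  | [::], _ => has (isomorphic (unzip1 s)) tables
  | v :: _, k.+1 =>
      all (fun S => all (fun m =>
        let d := size (nb s v) + size S + m in
        if (1 < d) && (d < 4) then search tables k (extend s v S m) else true)
        (iota 0 4)) (short_subseqs 3 (candidates s v))
  | _, 0 => false
  end.

End PartialGraphs.

Section Soundness.
Local Open Scope nat_scope.

Variables (V : choiceType) (adj : rel V) (N : V -> seq V) (x0 : V).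
Hypothesis lf : locally_flat adj N.

(** An embedding of a partial graph, as the list of the images of its vertices.
    *)
Definition realizes (s : partial_graph) (vs : seq V) : Prop :=
  [/\ size vs = size s, uniq vs,
      forall i j, j \in nb s i -> adj (nth x0 vs i) (nth x0 vs j)
    & forall i w, flagged s i -> adj (nth x0 vs i) w ->
        exists2 j, j \in nb s i & w = nth x0 vs j].

Lemma nb_default s i : size s <= i -> nb s i = [::].
Proof. by move=> si; rewrite /nb nth_default ?size_map. Qed.

Lemma nb_nonempty s i j : j \in nb s i -> i < size s.
Proof. by case: (ltnP i (size s)) => // /nb_default ->. Qed.

Lemma well_formedP s : well_formed s ->
  (forall i, uniq (nb s i)) /\
  (forall i j, j \in nb s i -> j < size s /\ i \in nb s j).
Proof.
move=> /allP wf; split=> [i|i j ij].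
  case: (ltnP i (size s)) => [si|/nb_default -> //].
  by have := wf i; rewrite mem_iota si => /(_ isT) /andP[].
have := wf i; rewrite mem_iota (nb_nonempty ij) => /(_ isT).
by case/andP=> _ /allP /(_ _ ij)/andP.
Qed.

Section Realized.
Variables (s : partial_graph) (vs : seq V).
Hypotheses (wf : well_formed s) (sz : size vs = size s) (uvs : uniq vs).
Hypothesis adjs : forall i j, j \in nb s i -> adj (nth x0 vs i) (nth x0 vs j).
Hypothesis closed : forall i w, flagged s i -> adj (nth x0 vs i) w ->
  exists2 j, j \in nb s i & w = nth x0 vs j.

Local Notation v := (nth x0 vs).

Let uniq_nb i : uniq (nb s i). Proof. by have [] := well_formedP wf. Qed.

Let nbC i j : j \in nb s i -> i \in nb s j.
Proof. by move=> ij; have [_ /(_ _ _ ij)[]] := well_formedP wf. Qed.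

Let nb_lt i j : j \in nb s i -> j < size s.
Proof. by move=> /nbC/nb_nonempty. Qed.

Let v_inj i j : i < size s -> j < size s -> v i = v j -> i = j.
Proof. by move=> si sj /eqP; rewrite nth_uniq ?sz // => /eqP. Qed.

Let uniq_map_nb i : uniq (map v (nb s i)).
Proof.
by rewrite map_inj_in_uniq // => j k /nb_lt sj /nb_lt sk; apply: v_inj.
Qed.

Let sub_nbs i : {subset map v (nb s i) <= N (v i)}.
Proof. by move=> _ /mapP[j ij ->]; rewrite (lf_nbrs lf) adjs. Qed.

Lemma full_perm i : full s i -> perm_eq (map v (nb s i)) (N (v i)).
Proof.
move=> fi; rewrite uniq_perm ?(lf_uniq lf) //.
case/orP: fi => [fl|si] w.
  apply/idP/idP => [/sub_nbs //|].
  rewrite (lf_nbrs lf) => /(closed fl)[j ij ->].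
  exact: map_f.
have [] // := uniq_min_size (uniq_map_nb i) (@sub_nbs i).
have /andP[_] := lf_degree lf (v i).
by rewrite size_map ltnS => /leq_trans; apply.
Qed.

Lemma full_closed i w : full s i -> adj (v i) w ->
  exists2 j, j \in nb s i & w = v j.
Proof.
by move=> /full_perm/perm_mem e; rewrite -(lf_nbrs lf) -e => /mapP.
Qed.

Lemma full_nb i j : full s i -> j < size s -> adj (v i) (v j) -> j \in nb s i.
Proof.
move=> fi js /(full_closed fi)[k ik /v_inj] -> //; exact: nb_lt ik.
Qed.

Lemma common_share i j : common s i j -> share adj N (v i) (v j).
Proof.
case/hasP=> k ki kj; apply/hasP; exists (v k); last exact: adjs.
by rewrite (lf_nbrs lf) adjs.
Qed.

(** A common neighbour of [v i] and [v j] is some [v k] with [k] full, so [j]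
    is listed at [k], hence also [k] at [j]. *)
Lemma share_common i j : j < size s -> explored s i ->
  share adj N (v i) (v j) -> common s i j.
Proof.
move=> js /andP[fi /allP fn] /hasP[w].
rewrite (lf_nbrs lf) => /(full_closed fi)[k ik ->] jk.
apply/hasP; exists k => //; apply/nbC/full_nb; rewrite ?fn //.
by rewrite (lf_sym lf).
Qed.

Lemma commonC i j : common s i j = common s j i.
Proof. by apply/hasP/hasP => -[w]; exists w. Qed.

Lemma share_maybe_common i j : i < size s -> j < size s ->
  share adj N (v i) (v j) -> maybe_common s i j.
Proof.
move=> si js sh; apply/orP; case: (boolP [|| _, _ | _]); last by right.
move=> ex; left; case/or3P: ex => [ei|ej|/andP[fi fj]].
- exact: share_common.
- by rewrite commonC; apply: share_common; rewrite // (share_sym (lf_nbrs lf)).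
case/hasP: sh => w; rewrite (lf_nbrs lf) => /(full_closed fi)[k ik ->].
move=> /(full_nb fj) jk; apply/hasP; exists k => //.
by apply: jk; apply: nb_lt ik.
Qed.

Lemma realizes_admissible : admissible s.
Proof.
apply/allP=> i _; apply/allP=> j ij; apply/and3P; split.
- apply/negP=> /hasP[k ik jk].
  exact: (lf_triangle lf (adjs ij) (adjs ik) (adjs jk)).
- apply/allP=> k ik; case: eqVneq => //= jk; apply/hasP=> -[l jl /andP[li kl]].
  have vjk : v j != v k by rewrite nth_uniq ?sz ?(nb_lt ij) ?(nb_lt ik).
  have /eqP := lf_square lf vjk (adjs jl) (adjs kl)
     (adjs (nbC ij)) (adjs (nbC ik)).
  by rewrite nth_uniq ?sz ?(nb_lt jl) ?(nb_nonempty ij) // (negPf li).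
apply/implyP=> fi; apply/implyP=> fj.
have rem_perm a b : full s a -> b \in nb s a ->
    perm_eq (map v (rem b (nb s a))) (rem (v b) (N (v a))).
  move=> fa ab; rewrite -(perm_cons (v b)) -map_cons.
  have /perm_trans -> // : perm_eq (map v (b :: rem b (nb s a))) (N (v a)).
    rewrite perm_sym (perm_trans _ (perm_map v (perm_to_rem ab))) //.
    by rewrite perm_sym full_perm.
  by apply: perm_to_rem; rewrite (lf_nbrs lf) adjs.
apply: (@flat_pair_map _ _ v (share adj N)).
- by move=> a b _ _; apply: common_share.
- by move=> a b /mem_rem ia /mem_rem jb; apply: share_maybe_common;
    [exact: nb_lt ia|exact: nb_lt jb].
apply: flat_pair_perm (lf_flat lf (adjs ij)); first exact: rem_perm.
by apply: rem_perm => //; apply: nbC.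
Qed.

(** The image of a partial graph whose vertices are all full is closed under
    adjacency, hence is everything by connectedness. *)
Lemma complete_iso :
    graph_connected adj -> 0 < size s -> (forall i, i < size s -> full s i) ->
  graph_iso adj (@table_graph (unzip1 s)).
Proof.
move=> conn s0 fs; apply: graph_iso_sym.
have lt (i : 'I_(size (unzip1 s))) : i < size s.
  by apply: leq_trans (ltn_ord i) _; rewrite size_map.
exists (fun i : 'I_(size (unzip1 s)) => v i); last first.
  move=> i j; apply/idP/idP => [/adjs //|]; exact: full_nb (fs _ (lt i)) (lt j).
have surj x : x \in vs.
  have v0 : v 0 \in vs by rewrite mem_nth ?sz.
  have [p [pp <- _]] := conn (v 0) x.
  elim: p (v 0) v0 pp => //= y p IHp a /(nthP x0)[i si <-] /andP[ay].
  apply: IHp; have [|k /nb_lt ks ->] := full_closed _ ay.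
    by apply: fs; rewrite -sz.
  by rewrite mem_nth ?sz.
have idx x : index x vs < size (unzip1 s) by rewrite size_map -sz index_mem.
exists (fun x => Ordinal (idx x)) => [i|x /=]; last by rewrite nth_index.
by apply: val_inj; rewrite /= index_uniq ?sz.
Qed.

End Realized.

Lemma nb_extend s u S m i :
  nb (extend s u S m) i =
  if i < size s then
    if i == u then nb s u ++ S ++ iota (size s) m
    else if i \in S then u :: nb s i else nb s i
  else if i < size s + m then [:: u] else [::].
Proof.
rewrite /nb /extend /unzip1 map_cat nth_cat -map_comp size_map size_iota.
case: ltnP => si.
  rewrite (nth_map 0) ?size_iota // nth_iota // add0n /=.
  by case: eqP => //; case: ifP.
rewrite map_nseq nth_nseq ltn_subLR //.
Qed.

Lemma flagged_extend s u S m i :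
  flagged (extend s u S m) i = (i < size s) && ((i == u) || flagged s i).
Proof.
rewrite /flagged /extend /unzip2 map_cat nth_cat -map_comp size_map size_iota.
case: ltnP => si.
  rewrite (nth_map 0) ?size_iota // nth_iota // add0n /=.
  by case: eqP => //; case: ifP.
by rewrite map_nseq nth_nseq; case: ifP.
Qed.

Lemma size_extend s u S m : size (extend s u S m) = size s + m.
Proof. by rewrite size_cat size_map size_iota size_nseq. Qed.

Lemma filter_short_subseqs (T : eqType) (p : pred T) k l :
  size (seq.filter p l) <= k -> seq.filter p l \in short_subseqs k l.
Proof.
elim: l k => [|x l IHl] [|k] //=.
- by case: ifP => // _; rewrite leqn0 => /nilP->.
rewrite mem_cat; case: ifP => _ /= le.
  by rewrite map_f ?IHl.
by rewrite IHl ?orbT.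
Qed.

(** The branch to follow is read off the actual neighbours of [v u]: those
    already embedded form [S], the others number [m] and are appended. *)
Lemma extend_realizes s vs u : well_formed s -> realizes s vs ->
    u < size s -> ~~ full s u ->
  exists S m vs', [/\ S \in short_subseqs 3 (candidates s u), m < 4,
    1 < size (nb s u) + size S + m < 4 & realizes (extend s u S m) vs'].
Proof.
move=> wf [sz uvs adjs cl] us nfu.
have [unb wfn] := well_formedP wf.
pose v := nth x0 vs.
pose S := [seq j <- candidates s u | adj (v u) (v j)].
pose W := [seq w <- N (v u) | w \notin vs].
have SP j : j \in S -> [/\ j < size s, j != u, j \notin nb s u,
    ~~ full s j & adj (v u) (v j)].
  by rewrite !mem_filter mem_iota add0n => /and3P[? /and3P[? ? ?] ?].
have deg : perm_eq (map v (nb s u ++ S) ++ W) (N (v u)).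
  rewrite uniq_perm ?(lf_uniq lf) //.
    rewrite cat_uniq filter_uniq ?(lf_uniq lf) // andbT.
    rewrite map_inj_in_uniq; last first.
      have lt j : j \in nb s u ++ S -> j < size s.
        by rewrite mem_cat => /orP[/wfn[]|/SP[]].
      by move=> i j /lt si /lt sj /eqP; rewrite nth_uniq ?sz // => /eqP.
    rewrite cat_uniq unb !filter_uniq ?iota_uniq // andbT.
    apply/andP; split.
      by apply/hasPn=> j /SP[].
    apply/hasPn=> w; rewrite mem_filter => /andP[+ _]; apply: contra.
    move=> /mapP[j]; rewrite mem_cat => /orP[/wfn[js _]|/SP[js _ _ _ _]] ->;
    by rewrite mem_nth ?sz.
  move=> w; rewrite mem_cat mem_filter (lf_nbrs lf).
  case: (boolP (w \in vs)) => [wvs|wnvs]; rewrite /= ?orbF; last first.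
    rewrite orb_idl // => /mapP[j]; rewrite mem_cat.
    by move=> /orP[/adjs ? ->|/SP[_ _ _ _ ?] ->].
  apply/mapP/idP => [[j + ->]|uw].
    by rewrite mem_cat => /orP[/adjs|/SP[]].
  move: wvs uw => /(nthP x0)[j js <-] uj; exists j => //.
  rewrite sz in js; rewrite mem_cat !mem_filter mem_iota add0n js uj /= andbT.
  case: (boolP (j \in nb s u)) => //= ju; apply/andP; split.
    by apply: contraTneq uj => ->; apply/negP => uu;
      exact: (lf_triangle lf uu uu uu).
  apply: contra ju => fj; apply: (proj2 (wfn _ _ _)).
  by apply: (@full_nb _ _ wf sz uvs adjs cl) => //; rewrite (lf_sym lf).
have szd : size (N (v u)) = size (nb s u) + size S + size W.
  by rewrite -(perm_size deg) size_cat size_map size_cat.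
have dd := lf_degree lf (v u); rewrite szd in dd.
exists S, (size W), (vs ++ W); split => //.
- apply: filter_short_subseqs; rewrite -/S.
  case/andP: dd => _; rewrite ltnS; apply: leq_trans.
  by rewrite -addnA addnCA leq_addr.
- by case/andP: dd => _; apply: leq_ltn_trans; apply: leq_addl.
have vE i : i < size s -> nth x0 (vs ++ W) i = v i.
  by move=> si; rewrite nth_cat sz si.
have wE i : size s <= i -> i < size s + size W ->
    adj (v u) (nth x0 (vs ++ W) i).
  move=> si iW; rewrite nth_cat sz ltnNge si /= -(lf_nbrs lf).
  have : nth x0 W (i - size s) \in W by rewrite mem_nth // ltn_subLR.
  by rewrite mem_filter => /andP[].
split.
- by rewrite size_cat size_extend sz.
- rewrite cat_uniq uvs filter_uniq ?(lf_uniq lf) // andbT.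
  by apply/hasPn => w; rewrite mem_filter => /andP[].
- move=> i j; rewrite nb_extend; case: ltnP => si; last first.
    case: ifP => // siW; rewrite inE => /eqP->.
    by rewrite (lf_sym lf) (vE _ us) wE.
  rewrite (vE _ si); case: eqP => [->|iu].
    rewrite !mem_cat mem_iota => /or3P[|/SP[js _ _ _ uj]|/andP[]].
    + by move=> ju; have [js _] := wfn _ _ ju; rewrite vE ?adjs.
    + by rewrite vE.
    + exact: wE.
  case: ifP => [/SP[_ _ _ _ ui]|_].
    rewrite inE => /orP[/eqP->|ij].
      by rewrite (vE _ us) (lf_sym lf).
    by have [js _] := wfn _ _ ij; rewrite vE ?adjs.
  by move=> ij; have [js _] := wfn _ _ ij; rewrite vE ?adjs.
move=> i w; rewrite flagged_extend nb_extend => /andP[si].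
rewrite si (vE _ si); case: eqP => [-> _|iu /= fi iw].
  rewrite -(lf_nbrs lf) -(perm_mem deg) mem_cat => /orP[/mapP[j ju ->]|wW].
    exists j; first by rewrite catA mem_cat ju.
    by rewrite vE //; move: ju; rewrite mem_cat => /orP[/wfn[]|/SP[]].
  exists (size s + index w W).
    by rewrite !mem_cat mem_iota leq_addr ltn_add2l index_mem wW !orbT.
  by rewrite nth_cat sz ltnNge leq_addr /= addKn nth_index.
have [j ij ->] := cl _ _ fi iw; have [js _] := wfn _ _ ij.
by exists j; [case: ifP => // _; rewrite inE ij orbT|rewrite vE].
Qed.

Lemma leaf_iso ts s vs : graph_connected adj -> 0 < size s ->
    well_formed s -> realizes s vs -> open_vertices s = [::] ->
    has (isomorphic (unzip1 s)) ts ->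
  exists2 t, t \in ts & graph_iso adj (@table_graph t).
Proof.
move=> conn s0 wf [sz uvs adjs cl] Eo /hasP[t tt /isomorphicP it].
exists t => //; apply: graph_iso_trans it.
apply: (complete_iso wf sz uvs adjs cl) => // i si; apply/negPn/negP => nfi.
have : i \in open_vertices s.
  by rewrite mem_cat !mem_filter mem_iota si nfi orbT.
by rewrite Eo.
Qed.

(** An embedding of the root descends along one branch of the tree; it cannot
    reach a contradictory leaf. *)
Lemma search_sound ts k s vs : graph_connected adj -> 0 < size s ->
    search ts k s -> realizes s vs ->
  exists2 t, t \in ts & graph_iso adj (@table_graph t).
Proof.
move=> conn; elim: k s vs => [|k IHk] s vs s0 srch rs.
all: have wf : well_formed s by move: srch => /=; case: (well_formed s).
all: have [sz uvs adjs cl] := rs.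
all: have ad := realizes_admissible wf sz uvs adjs cl.
all: move: srch; case Eo : (open_vertices s) => [|u o].
- by rewrite /= wf ad Eo; apply: leaf_iso rs Eo.
- by rewrite /= wf ad Eo.
- by rewrite /= wf ad Eo; apply: leaf_iso rs Eo.
have -> : search ts k.+1 s = all (fun S => all (fun m =>
    let d := size (nb s u) + size S + m in
    if (1 < d) && (d < 4) then search ts k (extend s u S m) else true)
    (iota 0 4)) (short_subseqs 3 (candidates s u)) by rewrite /= wf ad Eo.
move=> /allP srch.
have : u \in open_vertices s by rewrite Eo inE eqxx.
rewrite mem_cat 2!mem_filter mem_iota add0n => ou.
have {ou} [us nfu] : u < size s /\ ~~ full s u.
  by case/orP: ou => [/andP[_]|]; rewrite ?mem_filter ?mem_iota => /andP[].
have [S [m [vs' [Sin m4 deg rs']]]] := extend_realizes wf rs us nfu.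
have /allP/(_ m) := srch _ Sin; rewrite mem_iota m4 => /(_ isT).
rewrite /= deg => sk.
by apply: IHk sk rs'; rewrite size_extend addn_gt0 s0.
Qed.

End Soundness.

(** * The four graphs with a vertex of degree three *)

Section Targets.
Local Open Scope nat_scope.

Definition table_of (r : rel nat) (n : nat) : seq (seq nat) :=
  [seq [seq j <- iota 0 n | r i j] | i <- iota 0 n].

(** Vertex number [5 * l + i] of a table is the [i]-th one of layer [l]. *)
Definition layered (m k : nat) : 'I_m.+1 * 'Z_5 := (inZp (k %/ 5), inZp k).

Definition dodecahedral_table := Eval vm_compute in
  table_of (fun i j => dodecahedral (layered 3 i) (layered 3 j)) 20.

Definition half_dodecahedral_table := Eval vm_compute in
  table_of (fun i j => half_dodecahedral (layered 2 i) (layered 2 j)) 15.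

Definition triplex_table := Eval vm_compute in
  table_of (fun i j => triplex (inZp i) (inZp j)) 12.

(** The two-element subsets of ['I_5] as increasing pairs, in lexicographic
    order. *)
Definition increasing_pair (k : nat) : 'I_5 * 'I_5 :=
  let pairs := [seq p <- [seq (i, j) | i <- iota 0 5, j <- iota 0 5]
                 | p.1 < p.2] in
  (inZp (nth (0, 0) pairs k).1, inZp (nth (0, 0) pairs k).2).

Definition separate (T : eqType) (p q : T * T) : bool :=
  [&& p.1 != q.1, p.1 != q.2, p.2 != q.1 & p.2 != q.2].

Definition petersen_table := Eval vm_compute in
  table_of (fun i j => separate (increasing_pair i) (increasing_pair j)) 10.

Lemma table_graph_iso (T : finType) (r : rel T) t (g : 'I_(size t) -> T) :
    injective g -> #|T| = size t ->
    (forall i j : 'I_(size t), r (g i) (g j) = (val j \in nth [::] t i)) ->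
  graph_iso (@table_graph t) r.
Proof.
move=> gI cT rg; exists g; last by move=> i j; rewrite rg.
by apply: inj_card_bij => //; rewrite card_ord cT.
Qed.

Lemma nth_table_of r n i j : i < n -> j < n ->
  (j \in nth [::] (table_of r n) i) = r i j.
Proof.
move=> ni nj; rewrite (nth_map 0) ?size_iota // nth_iota // add0n.
by rewrite mem_filter mem_iota nj leq0n !andbT.
Qed.

Lemma size_table_of r n : size (table_of r n) = n.
Proof. by rewrite size_map size_iota. Qed.

Lemma table_of_iso (T : finType) (r : rel T) (g : nat -> T) n t :
    t = table_of (fun i j => r (g i) (g j)) n ->
    uniq [seq g i | i <- iota 0 n] -> #|T| = n ->
  graph_iso (@table_graph t) r.
Proof.
move=> et ug cT; have st : size t = n by rewrite et size_table_of.
have gI i j : i < n -> j < n -> g i = g j -> i = j.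
  move=> ni nj gij; apply/eqP.
  rewrite -(nth_uniq (g 0) _ _ ug) ?size_map ?size_iota //.
  by rewrite !(nth_map 0) ?size_iota // !nth_iota // gij.
have lt (i : 'I_(size t)) : i < n by apply: leq_trans (ltn_ord i) _; rewrite st.
apply: (@table_graph_iso _ _ _ (fun i => g i)).
- by move=> i j /(gI _ _ (lt i) (lt j)) /val_inj.
- by rewrite st.
by move=> i j; rewrite [t in nth _ t]et nth_table_of ?lt.
Qed.

Lemma card_layered m : #|{: 'I_m.+1 * 'Z_5}| = m.+1 * 5.
Proof. by rewrite card_prod !card_ord. Qed.

Lemma dodecahedral_iso :
  graph_iso (@table_graph dodecahedral_table) dodecahedral.
Proof.
by apply: (@table_of_iso _ _ (layered 3) 20); last exact: card_layered;
  vm_compute.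
Qed.

Lemma half_dodecahedral_iso :
  graph_iso (@table_graph half_dodecahedral_table) half_dodecahedral.
Proof.
by apply: (@table_of_iso _ _ (layered 2) 15); last exact: card_layered;
  vm_compute.
Qed.

Lemma triplex_iso : graph_iso (@table_graph triplex_table) triplex.
Proof.
by apply: (@table_of_iso _ _ (fun k => inZp k) 12); last exact: card_ord;
  vm_compute.
Qed.

Lemma disjoint_pairs (T : finType) (p q : T * T) :
  [disjoint [set p.1; p.2]%SET & [set q.1; q.2]%SET]%bool = separate p q.
Proof.
by rewrite finset.disjoints_subset finset.subUset !finset.sub1set
  !finset.in_setC !finset.in_set2 !negb_or -!andbA.
Qed.

Lemma card_two_subsets (n : nat) :
  #|{: {A : {set 'I_n} | #|A| == 2}}| = 'C(n, 2).
Proof.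
rewrite card_sig; have := card_draws 'I_n 2; rewrite card_ord => <-.
by apply: eq_card => A; rewrite !finset.inE.
Qed.

Lemma petersen_iso : graph_iso (@table_graph petersen_table) petersen.
Proof.
pose A (k : 'I_10) := let p := increasing_pair k in [set p.1; p.2]%SET.
have cA k : #|A k| == 2.
  rewrite cards2 eqSS; case: k => k /=; do 10?[case: k => [|k] //].
apply: (@table_graph_iso _ _ petersen_table
         (fun k : 'I_10 => exist _ (A k) (cA k))); last first.
- move=> i j; rewrite /petersen /= disjoint_pairs.
  by rewrite -(@nth_table_of (fun i j =>
    separate (increasing_pair i) (increasing_pair j)) 10).
- exact: card_two_subsets.
move=> i j [] /finset.setP eA; apply/val_inj/eqP.
pose code k := let p := increasing_pair k in
  [seq (inZp m == p.1) || (inZp m == p.2) | m <- iota 0 5].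
have uc : uniq [seq code k | k <- iota 0 10] by vm_compute.
have lt (k : 'I_(size petersen_table)) : val k < 10 by apply: ltn_ord.
rewrite -(nth_uniq [::] (s := map code (iota 0 10))) ?size_map ?size_iota;
  rewrite ?lt //.
rewrite !(nth_map 0) ?size_iota ?lt // !nth_iota ?lt //.
apply/eqP/eq_map => m /=.
by have := eA (inZp m); rewrite !finset.in_set2.
Qed.

Definition tables :=
  [:: dodecahedral_table; triplex_table; petersen_table;
      half_dodecahedral_table].

(** A pentagon [0 1 2 3 4] through a vertex [0] of degree 3, whose third
    neighbour is [5]. *)
Definition seed : partial_graph :=
  [:: ([:: 1; 4; 5], true); ([:: 0; 2], false); ([:: 1; 3], false);
      ([:: 2; 4], false); ([:: 3; 0], false); ([:: 0], false)].

Lemma search_seed : search tables 20 seed.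
Proof. by vm_compute. Qed.

(** At a vertex of degree 3, the local condition of any edge provides a
    pentagon through this edge, whatever the degree of the other end. *)
Lemma seed_realizes (V : choiceType) (adj : rel V) N (x0 : V) :
    locally_flat adj N -> size (N x0) = 3 ->
  exists vs, realizes adj x0 seed vs.
Proof.
move=> lf N3; have nE := lf_nbrs lf; have sym := lf_sym lf.
have irr x : ~~ adj x x.
  by apply/negP => xx; apply: (lf_triangle lf xx xx xx).
have tri x y z : adj x y -> adj x z -> ~~ adj y z.
  by move=> xy xz; apply/negP; apply: (lf_triangle lf xy xz).
have [y x0y] : exists y, adj x0 y.
  by case: (N x0) N3 (nE x0) => // y ? _ ny; exists y; rewrite -ny inE eqxx.
have yx0 : adj y x0 by rewrite sym.
have [a [c [x0a yc ay cx0 /hasP[w]]]] : exists a c,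
    [/\ adj x0 a, adj y c, a != y, c != x0 & share adj N a c].
  have memr u v z : z \in rem v (N u) -> z != v /\ adj u z.
    by rewrite mem_rem_uniq ?(lf_uniq lf) // -nE !inE => /andP.
  have : size (rem y (N x0)) = 2 by rewrite size_rem ?nE ?N3.
  have := lf_flat lf x0y; have := memr x0 y; have := memr y x0.
  case: (rem y _) => [|a [|b []]] //; case: (rem x0 _) => [|c [|d []]] //.
  - move=> mY mX /andP[_ /orP[ac|bc]] _.
      have [|ay x0a] := mX a; first by rewrite inE eqxx.
      have [|cx0 yc] := mY c; first by rewrite inE eqxx.
      by exists a, c.
    have [|ay x0a] := mX b; first by rewrite !inE eqxx orbT.
    have [|cx0 yc] := mY c; first by rewrite inE eqxx.
    by exists b, c.
  move=> mY mX /orP[]/andP[ac _] _.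
    have [|ay x0a] := mX a; first by rewrite inE eqxx.
    have [|cx0 yc] := mY c; first by rewrite inE eqxx.
    by exists a, c.
  have [|ay x0a] := mX a; first by rewrite inE eqxx.
  have [|dx0 yd] := mY d; first by rewrite !inE eqxx orbT.
  by exists a, d.
rewrite nE => aw cw.
have [b [x0b ba bY allN]] : exists b, [/\ adj x0 b, b != a, b != y &
    forall z, adj x0 z -> z \in [:: a; y; b]].
  have ya : y \in rem a (N x0).
    by rewrite mem_rem_uniq ?(lf_uniq lf) // inE nE x0y eq_sym ay.
  have pN : perm_eq (N x0) (a :: y :: rem y (rem a (N x0))).
    have /perm_trans-> // : perm_eq (N x0) (a :: rem a (N x0)).
      by apply: perm_to_rem; rewrite nE.
    by rewrite perm_cons perm_to_rem.
  have := perm_size pN; rewrite N3.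
  case E: (rem y _) pN => [|b []] //= pN _.
  have := perm_uniq pN; rewrite (lf_uniq lf) /= !inE negb_or => /esym/and3P.
  case=> /andP[_ ab] yb _.
  exists b; rewrite -nE (perm_mem pN) !inE eqxx !orbT; split=> //.
  - by rewrite eq_sym.
  - by rewrite eq_sym.
  by move=> z; rewrite -nE (perm_mem pN) !inE.
have ne u v z : adj u z -> ~~ adj v z -> u != v.
  by move=> uz; apply: contra => /eqP<-.
have ax0 : adj a x0 by rewrite sym.
have bx0 : adj b x0 by rewrite sym.
have cy : adj c y by rewrite sym.
have wa : adj w a by rewrite sym.
have wc : adj w c by rewrite sym.
exists [:: x0; a; w; c; y; b]; split=> //.
- rewrite /= !inE !negb_or.
  have x0w : x0 != w by rewrite (ne _ _ y) // sym (tri c).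
  have wy : w != y by rewrite (ne _ _ a) // (tri x0).
  have ac : a != c by rewrite (ne _ _ x0) // sym (tri y).
  have wb : w != b by rewrite (ne _ _ a) // (tri x0).
  have cb : c != b by rewrite (ne _ _ y) // (tri x0).
  have aw' : a != w by apply: contraTneq aw => <-.
  have wc' : w != c by apply: contraTneq wc => <-.
  have cy' : c != y by apply: contraTneq cy => <-.
  have x0a' : x0 != a by apply: contraTneq x0a => <-.
  have x0y' : x0 != y by apply: contraTneq x0y => <-.
  have x0b' : x0 != b by apply: contraTneq x0b => <-.
  rewrite x0w x0a' x0y' x0b' aw' ac ay (eq_sym a) ba wc' wy wb cy' cb.
  by rewrite (eq_sym x0) cx0 (eq_sym y) bY.
- move=> i j ij; have := nb_nonempty ij; move: ij.
  do 6?[case: i => [|i] //]; rewrite [nb _ _]/= !inE => + _.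
  + by case/or3P=> /eqP->.
  all: try by case/orP=> /eqP->.
  by move/eqP->.
case=> [|i] z; last first.
  by do 6?[case: i => [|i] //]; rewrite /flagged /= nth_nil.
move=> _ /allN; rewrite !inE => /or3P[]/eqP->; by [exists 1|exists 4|exists 5].
Qed.

Lemma locally_flat_cubic_vertex (V : choiceType) (adj : rel V) N (x0 : V) :
    locally_flat adj N -> graph_connected adj -> size (N x0) = 3 ->
  [\/ graph_iso adj dodecahedral, graph_iso adj triplex,
      graph_iso adj petersen | graph_iso adj half_dodecahedral].
Proof.
move=> lf conn /(seed_realizes lf)[vs rs].
have [t] := search_sound lf conn (isT : 0 < size seed) search_seed rs.
rewrite !inE => /or4P[]/eqP-> /graph_iso_trans it.
- by apply: Or41; apply: it dodecahedral_iso.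
- by apply: Or42; apply: it triplex_iso.
- by apply: Or43; apply: it petersen_iso.
- by apply: Or44; apply: it half_dodecahedral_iso.
Qed.

End Targets.

Theorem theorem2 (R : realType) (V : choiceType) (adj : rel V)
    (adj_sym : symmetric adj) (adj_irr : irreflexive adj)
    (adj_fin : locally_finite adj) (adj_conn : graph_connected adj)
    (adj_edge : exists x y : V, adj x y)
    (adj_girth : (5%:R%:E <= girth adj R)%E)
    (adj_flat : Ricci_flat adj R) :
  graph_iso adj infinite_path
  \/ (exists2 n : nat, (6 <= n)%N & graph_iso adj (@cycle_graph n))
  \/ graph_iso adj dodecahedral
  \/ graph_iso adj triplex
  \/ graph_iso adj petersen
  \/ graph_iso adj half_dodecahedral.
Proof.
have lf := flat_locally_flat adj_sym adj_irr adj_fin adj_girth adj_flat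
  adj_conn adj_edge.
have [x0 [_ _]] := adj_edge.
have [[x x3]|no3] := pselect (exists x, size (nbrs adj x) = 3%N).
  by right; right; case: (locally_flat_cubic_vertex lf adj_conn x3); tauto.
have deg2 x : size (nbrs adj x) = 2%N.
  have := lf_degree lf x; case E : size => [|[|[|[|n]]]] // _.
  by case: no3; exists x.
by case: (two_regular_iso x0 lf adj_conn deg2); tauto.
Qed.
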